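(* Let $\mathbb{K}$ be a field of characteristic $0$, let $R=\mathbb{K}[x,y,z]$ with the standard grading, and let $l,k$ be non-negative integers such that $l+k(3-r)>0$ for $r=1,2,3$. Let $$J_{\phi} = \langle x^{l+2k},\ y^{l+2k},\ z^{l+2k},\ (x+y)^{2l+2k},\ (x+z)^{2l+2k},\ (y+z)^{2l+2k},\ (x+y+z)^{3l} \rangle\subset R.$$ Then the minimal free resolution of $J_{\phi}$ is given by $$0 \to R(-3l-3k)^6 \to R(-2l-3k)^6\oplus R(-3l-2k)^6 \to R(-l-2k)^3\oplus R(-2l-2k)^3\oplus R(-3l) \to R \to R/J_{\phi} \to 0.$$
   Context: $R(-d)$ denotes the graded free $R$-module of rank one with generator in degree $d$. The resolution is the minimal graded free resolution of $R/J_\phi$ over $R$, with all maps homogeneous of degree $0$.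
   Formalization: Minimality is asserted only for k > 0: when k = 0 the ideal is ⟨x^l, y^l, z^l⟩, whose minimal resolution is the Koszul complex, so the displayed sequence is then a graded free resolution but not minimal. *)

(* Defs.v *)
From HB Require Import structures.
From mathcomp Require Import all_boot all_order all_algebra.
From mathcomp Require Import mpoly.

Set Implicit Arguments.
Unset Strict Implicit.
Unset Printing Implicit Defensive.

Import GRing.Theory.
Local Open Scope ring_scope.

Section GradedResolutions.
Variables (K : fieldType) (n : nat).
Local Notation R := {mpoly K[n]}.

Definition ideal_gen (s : seq R) (p : R) : Prop :=
  exists c : 'I_(size s) -> R, p = \sum_(i < size s) c i * s`_i.

Definition irrelevant_ideal : R -> Prop := ideal_gen [seq 'X_i | i : 'I_n].

(* gfree [:: d_1; ...; d_m] is R(-d_1) + ... + R(-d_m): the i-th basis vector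
   has degree d_i.  Only the predicate ghomog below sees the degrees. *)
Definition gfree (ds : seq nat) : lmodType R := 'rV[R]_(size ds).

(* The i-th coordinate of a vector of degree e lies in R(-d_i)_e = R_(e - d_i),
   which is 0 when e < d_i. *)
Definition ghomog (ds : seq nat) (e : nat) (v : 'rV[R]_(size ds)) : Prop :=
  forall i : 'I_(size ds),
    ((nth 0%N ds i <= e)%N -> v ord0 i \is (e - nth 0%N ds i)%N.-homog) /\
    ((e < nth 0%N ds i)%N -> v ord0 i = 0).

Definition degree0_map (ds ds' : seq nat) (f : gfree ds -> gfree ds') : Prop :=
  forall (e : nat) (v : gfree ds), ghomog e v -> ghomog e (f v).

(* F_0 = R, F_i = gfree (nth [::] Fs i.-1) for 0 < i <= size Fs, and F_i = 0 for
   i > size Fs. *)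
Definition shift (Fs : seq (seq nat)) (i : nat) : seq nat :=
  nth [::] ([:: 0%N] :: Fs) i.

Definition differentials (Fs : seq (seq nat)) : Type :=
  forall i : nat, {linear gfree (shift Fs i.+1) -> gfree (shift Fs i)}.

(* The complex ... -> F_2 -> F_1 -> R -> R/J -> 0, with R -> R/J the canonical
   surjection, is exact; exactness at R says that the image of F_1 is J. *)
Definition graded_free_resolution (J : R -> Prop) (Fs : seq (seq nat))
    (d : differentials Fs) : Prop :=
  [/\ forall i, degree0_map (d i),
      forall p : R, J p <-> exists v, (d 0%N v : 'rV[R]_1) ord0 ord0 = p
    & forall i (v : gfree (shift Fs i.+1)),
        d i v = 0 <-> exists w, d i.+1 w = v].

(* Minimality: the image of F_(i+1) lies in mF_i, m the irrelevant ideal. *)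
Definition minimal_differentials (Fs : seq (seq nat)) (d : differentials Fs) :
    Prop :=
  forall i v (j : 'I_(size (shift Fs i))),
    irrelevant_ideal ((d i v : 'rV[R]_(size (shift Fs i))) ord0 j).

End GradedResolutions.

Definition J_phi (K : fieldType) (l k : nat) : {mpoly K[3]} -> Prop :=
  let x : {mpoly K[3]} := 'X_(@Ordinal 3 0 isT) in
  let y : {mpoly K[3]} := 'X_(@Ordinal 3 1 isT) in
  let z : {mpoly K[3]} := 'X_(@Ordinal 3 2 isT) in
  ideal_gen
    [:: x ^+ (l + 2 * k); y ^+ (l + 2 * k); z ^+ (l + 2 * k);
        (x + y) ^+ (2 * l + 2 * k); (x + z) ^+ (2 * l + 2 * k);
        (y + z) ^+ (2 * l + 2 * k);
        (x + y + z) ^+ (3 * l)].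
Arguments J_phi K l k _ : clear implicits.

(* Degrees of the basis elements of F_1, F_2 and F_3.  When k = 0 the ideal
   J_phi is (x^l, y^l, z^l), whose minimal resolution is the Koszul complex, so
   a resolution with these shifts exists but is not minimal. *)
Definition phi_shifts (l k : nat) : seq (seq nat) :=
  [:: nseq 3 (l + 2 * k)%N ++ nseq 3 (2 * l + 2 * k)%N ++ [:: (3 * l)%N];
      nseq 6 (2 * l + 3 * k)%N ++ nseq 6 (3 * l + 2 * k)%N;
      nseq 6 (3 * l + 3 * k)%N].

(* Main.v *)
Require Import Defs.
From HB Require Import structures.
From mathcomp Require Import all_boot all_order all_algebra.
From mathcomp Require Import mpoly.
From mathcomp Require Import ring zify.

Import GRing.Theory.
Local Open Scope ring_scope.

Set Implicit Arguments.
Unset Strict Implicit.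
Unset Printing Implicit Defensive.

(** The seven forms [x], [y], [z], [x + y], [x + z], [y + z], [x + y + z] are
    points, and the six functionals [u], [v], [w], [u - v], [u - w], [v - w]
    on the space of linear forms are lines; each line contains three of the
    points, two lines always meet in one of the points, and the pattern is
    that of the braid arrangement, that is of the complete graph on four
    vertices with the lines as edges.  Give the lines multiplicities, [l] for
    the first three and [k] for the last three.  The exponent of a point [p]
    in the ideal is the number [cut m p] of lines off [p], counted with
    multiplicity.  The proof works for every multiset [m] of lines.

    Instead of the coefficients of a syzygy it uses the products: a syzygy of
    the powers is a family of polynomials [S_p] with sum [0] in which [S_p] is
    divisible by the power of [p].  The point of this is that such families
    behave well under the derivative [d_e] in the direction of a line [e].
    It kills the points of [e] and maps every other point to a nonzero
    constant, so it sends families for [e :: m] to families for [m]; and off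
    [e] it can be inverted, because a polynomial has exactly one
    antiderivative divisible by a given [p] with [d_e p <> 0]
    ([ddir_antiderivative], [ddir_inj]).

    Consider first the families supported on the three points of a line [H].
    For [e <> H] only one point [p0] of [H] lies on [e], and its component is
    minus the sum of the others.  So [d_e] is injective, and an antiderivative
    exists as soon as its component at [p0] is divisible by the right power of
    [p0].  Both the [e]- and the [H]-derivative of this component are divisible
    by that power, and then Euler's formula shows that the component is too
    ([lift_divides], [line_flow_lift]).

    Lifting all lines but [e] separately and letting [e] carry what is left
    gives [decomposes_lift], and by induction on [m] two facts.  Every syzygy
    of the seven powers is a sum of syzygies along the lines ([decompose]).
    And the relations between these, namely the families indexed by flags
    (point, line) with all sums over a line and over a point equal to [0],
    are mapped injectively, by the product of all the derivatives in [m], to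
    the same kind of families without divisibility condition, where every
    constant family has a preimage ([decomposes_iter_ddir_inj],
    [decomposes_iter_ddir_lift]).  The constant families form a space of
    dimension [2] for one line and [6] for the whole configuration.

    It remains to pass from such a bijection to freeness
    ([rows_independent], [free_kernel]).  Both modules are kernels of matrices
    whose image is saturated with respect to one variable, so the three
    variables form a regular sequence on them, and elements that are linearly
    independent over the field in the lowest degree are independent over the
    polynomial ring.  That they generate is then a dimension count, degree by
    degree.  Hence each line contributes two generators to the first syzygies
    ([line_basis]), in degree [size m] minus the multiplicity of the line, and
    the second syzygies are free on six generators of degree [size m]
    ([second_syzygies]).  With the multiplicities above these degrees are
    [2l + 3k], [3l + 2k] and [3l + 3k].  For positive [k] the nonzero entries
    of all the matrices have positive degree. *)
(** * Divisibility and homogeneous components *)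

Section Divides.
Variables (K : fieldType) (n : nat).
Local Notation R := {mpoly K[n]}.
Implicit Types (a b g h q : R).

Definition divides a b : Prop := exists c, b = c * a.

Lemma divides0 a : divides a 0.
Proof. by exists 0; rewrite mul0r. Qed.

Lemma divides_refl a : divides a a.
Proof. by exists 1; rewrite mul1r. Qed.

Lemma dividesD a b c : divides a b -> divides a c -> divides a (b + c).
Proof. by move=> [u ->] [v ->]; exists (u + v); rewrite mulrDl. Qed.

Lemma dividesN a b : divides a b -> divides a (- b).
Proof. by move=> [u ->]; exists (- u); rewrite mulNr. Qed.

Lemma dividesZ k a b : divides a b -> divides a (k *: b).
Proof. by move=> [u ->]; exists (k *: u); rewrite scalerAl. Qed.

Lemma dividesMl a b c : divides a b -> divides a (c * b).
Proof. by move=> [u ->]; exists (c * u); rewrite mulrA. Qed.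

Lemma divides_sum (I : Type) (r : seq I) (P : pred I) a (F : I -> R) :
  (forall i, P i -> divides a (F i)) -> divides a (\sum_(i <- r | P i) F i).
Proof.
move=> dF; elim/big_ind: _ => //; first exact: divides0.
by move=> x y; apply: dividesD.
Qed.

Lemma dividesX a b i j : (i <= j)%N -> divides (a ^+ j) b -> divides (a ^+ i) b.
Proof.
by move=> ij [u ->]; exists (u * a ^+ (j - i)); rewrite -mulrA -exprD subnK.
Qed.

Lemma pihomogM d e g q : q \is e.-homog ->
  pihomog mdeg (d + e) (g * q) = pihomog mdeg d g * q.
Proof.
move=> hq; have := pihomog_partitionE (leqnn (mmeasure mdeg g)).
set s := \sum_(i < _) _ => ->; rewrite /s.
rewrite raddf_sum !mulr_suml raddf_sum; apply: eq_bigr => i _ /=.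
have hi := pihomogP mdeg i g; have hM := dhomogM hi hq.
have [<-|ne] := eqVneq (i : nat) d; first by rewrite (pihomog_dE hM) (pihomog_dE hi).
by rewrite (pihomog_ne0 _ hM) ?(pihomog_ne0 _ hi) ?mul0r // eqn_add2r.
Qed.

Lemma pihomogM_lt d e g q : q \is e.-homog -> (d < e)%N ->
  pihomog mdeg d (g * q) = 0.
Proof.
move=> hq lt_de; rewrite {1}(pihomog_partitionE (leqnn (mmeasure mdeg g))).
rewrite mulr_suml raddf_sum big1 // => i _ /=.
apply: pihomog_ne0 (dhomogM (pihomogP mdeg i g) hq).
by apply: contraTneq lt_de => <-; rewrite -leqNgt leq_addl.
Qed.

Lemma divides_homog d e g q : q \is e.-homog -> g \is (d + e).-homog ->
  divides q g -> exists2 h, h \is d.-homog & g = h * q.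
Proof.
move=> hq hg [c def_g]; exists (pihomog mdeg d c); first exact: pihomogP.
by rewrite -(pihomogM _ _ hq) -def_g pihomog_dE.
Qed.

Lemma divides_homog_lt d e g q : q \is e.-homog -> g \is d.-homog -> (d < e)%N ->
  divides q g -> g = 0.
Proof.
move=> hq hg lt_de [c def_g]; rewrite -(pihomog_dE hg) def_g.
exact: pihomogM_lt hq lt_de.
Qed.

End Divides.

(** * Directional derivatives *)

Section Directional.
Variables (K : fieldType) (n : nat).
Local Notation R := {mpoly K[n]}.
Implicit Types (w c : 'I_n -> K) (g h q : R).

Definition linform c : R := \sum_i c i *: 'X_i.

Definition ddir w g : R := \sum_i w i *: g^`M(i).

Lemma ddir_is_linear w : linear (ddir w).
Proof.
move=> k g h; rewrite /ddir scaler_sumr -big_split /=; apply: eq_bigr => i _.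
by rewrite linearP /= scalerDr !scalerA mulrC.
Qed.

HB.instance Definition _ w :=
  GRing.isLinear.Build K R R _ (ddir w) (ddir_is_linear w).

Lemma ddir_sum (I : Type) (r : seq I) (P : pred I) w (F : I -> R) :
  ddir w (\sum_(i <- r | P i) F i) = \sum_(i <- r | P i) ddir w (F i).
Proof. exact: raddf_sum. Qed.

Lemma ddir0 w : ddir w 0 = 0.
Proof. exact: raddf0. Qed.

Lemma ddirM w g h : ddir w (g * h) = ddir w g * h + g * ddir w h.
Proof.
rewrite /ddir mulr_suml mulr_sumr -big_split /=; apply: eq_bigr => i _.
by rewrite mderivM scalerDr scalerAl scalerAr.
Qed.

Lemma ddirC w w' g : ddir w (ddir w' g) = ddir w' (ddir w g).
Proof.
rewrite /ddir; under eq_bigr => i _ do rewrite (raddf_sum (mderiv i)) scaler_sumr.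
under [RHS]eq_bigr => i _ do rewrite (raddf_sum (mderiv i)) scaler_sumr.
rewrite exchange_big; apply: eq_bigr => i _; apply: eq_bigr => j _ /=.
by rewrite !mderivZ !scalerA mulrC mderiv_comm.
Qed.

Lemma ddir_linform w c : ddir w (linform c) = (\sum_i w i * c i)%:MP.
Proof.
rewrite /ddir /linform (raddf_sum (@mpolyC n K)) /=; apply: eq_bigr => i _.
rewrite (raddf_sum (mderiv i)) /= (bigD1 i) //= big1 ?addr0 => [|j ne_ji].
  rewrite mderivZ mderivX mnmE eqxx scale1r -[X in (X - _)%MM]add0m addmK mpolyX0.
  by rewrite scalerA -mul_mpolyC mulr1.
by rewrite mderivZ mderivX mnmE (negbTE ne_ji) scale0r scaler0.
Qed.

Lemma ddirXn w k q m : ddir w q = k%:MP ->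
  ddir w (q ^+ m.+1) = (m.+1%:R * k) *: q ^+ m.
Proof.
move=> dq; elim: m => [|m IH]; first by rewrite expr1 expr0 mul1r dq -mul_mpolyC mulr1.
rewrite exprS ddirM IH dq mul_mpolyC -scalerAr -exprS -scalerDl.
by rewrite (mulrSr _ m.+1) mulrDl mul1r addrC.
Qed.

Lemma ddirMXn w k q g m : ddir w q = k%:MP ->
  ddir w (g * q ^+ m.+1) = (ddir w g * q + (m.+1%:R * k) *: g) * q ^+ m.
Proof.
move=> dq; rewrite ddirM (ddirXn _ dq) exprS mulrDl mulrA.
by rewrite -scalerAr -scalerAl.
Qed.

Lemma linform_homog c : linform c \is 1.-homog.
Proof. by apply: rpred_sum => i _; apply: rpredZ; rewrite dhomogX /= mdeg1. Qed.

Lemma mderiv_homog i d g : g \is d.+1.-homog -> g^`M(i) \is d.-homog.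
Proof.
move=> hg; apply/dhomogP => m; rewrite mcoeff_msupp mcoeff_mderiv => nz.
have := dhomogP _ _ _ hg (m + U_(i))%MM; rewrite mcoeff_msupp.
have nz' : g@_(m + U_(i)) != 0 by apply: contraNneq nz => ->; rewrite mul0rn.
by move/(_ nz'); rewrite /= mdegD mdeg1 addn1 => -[].
Qed.

Lemma mderiv_homog0 i g : g \is 0.-homog -> g^`M(i) = 0.
Proof.
move=> hg; apply/mpolyP => m; rewrite mcoeff_mderiv mcoeff0.
by rewrite (dhomog_nemf_coeff hg) ?mul0rn //= mdegD mdeg1 addn1.
Qed.

Lemma ddir_homog w d g : g \is d.+1.-homog -> ddir w g \is d.-homog.
Proof. by move=> hg; apply: rpred_sum => i _; rewrite rpredZ ?mderiv_homog. Qed.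

Lemma ddir_homog0 w g : g \is 0.-homog -> ddir w g = 0.
Proof.
by move=> hg; rewrite /ddir big1 // => i _; rewrite mderiv_homog0 ?scaler0.
Qed.

Lemma euler_homog d g : g \is d.-homog -> \sum_i 'X_i * g^`M(i) = d%:R *: g.
Proof.
move=> hg; have /dhomogP dg := hg.
have E i : 'X_i * g^`M(i) = \sum_(m <- msupp g) 'X_i * (g@_m *: 'X_[m])^`M(i).
  by rewrite {1}[g]mpolyE (raddf_sum (mderiv i)) mulr_sumr.
rewrite [g in RHS]mpolyE scaler_sumr (eq_bigr _ (fun i _ => E i)).
rewrite exchange_big /= big_seq [RHS]big_seq; apply: eq_bigr => m /dg dm.
transitivity (\sum_(i < n) (g@_m * (m i)%:R) *: 'X_[m] : R).
  apply: eq_bigr => i _; rewrite mderivZ mderivX scalerA -scalerAr -mpolyXD.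
  have [-> | nz] := eqVneq (m i) 0%N; first by rewrite mulr0 !scale0r.
  rewrite addmC submK //; apply/mnm_lepP => j; rewrite mnmE.
  by case: eqP => // <-; rewrite lt0n.
rewrite -scaler_suml scalerA -mulr_sumr -natr_sum -mdegE [mdeg m]dm.
by rewrite mulrC.
Qed.

End Directional.

(** * Antiderivatives that vanish on a line, and divisibility by a power *)

Section CharZero.
Variables (K : fieldType) (n : nat).
Hypothesis charK : [pchar K] =i pred0.
Local Notation R := {mpoly K[n]}.
Implicit Types (w c : 'I_n -> K) (g h q : R).

Lemma natS_neq0 m : m.+1%:R != 0 :> K.
Proof. by rewrite ((pcharf0P K).1 charK). Qed.

(** Repeated integration by parts, which ends because each step lowers the
    degree of the cofactor [h]. *)
Lemma ddir_antiderivative w k q a j h :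
    ddir w q = k%:MP -> k != 0 -> q \is 1.-homog -> h \is j.-homog ->
  exists2 g, g \is j.-homog & ddir w (g * q ^+ a.+1) = h * q ^+ a.
Proof.
move=> dq nzk hq; elim: j a h => [|j IH] a h hh.
  have nz : a.+1%:R * k != 0 by rewrite mulf_neq0 ?natS_neq0.
  exists ((a.+1%:R * k)^-1 *: h); first by rewrite rpredZ.
  rewrite (ddirMXn _ _ dq) linearZ /= ddir_homog0 // scaler0 mul0r add0r.
  by rewrite scalerA mulfV // scale1r.
have nz : a.+1%:R * k != 0 by rewrite mulf_neq0 ?natS_neq0.
have [g hg dg] := IH a.+1 _ (ddir_homog w hh).
exists ((a.+1%:R * k)^-1 *: (h - g * q)).
  by rewrite rpredZ // rpredB // -addn1 dhomogM.
have ->: (a.+1%:R * k)^-1 *: (h - g * q) * q ^+ a.+1 =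
   (a.+1%:R * k)^-1 *: (h * q ^+ a.+1 - g * q ^+ a.+2).
  by rewrite -scalerAl mulrBl -mulrA -exprS.
rewrite linearZ linearB /= dg (ddirMXn h _ dq).
by rewrite exprS mulrDl -mulrA addrAC subrr add0r -scalerAl scalerA mulVf ?scale1r.
Qed.

(** If [g = f * q ^+ a.+1] has derivative [0], then [f] is a multiple of
    [ddir w f * q]; so [ddir w f * q ^+ a.+2] has derivative [0] too.  By
    induction on the degree [ddir w f] vanishes, and [f] with it. *)
Lemma ddir_inj w k q d g :
    ddir w q = k%:MP -> k != 0 -> q \is 1.-homog -> g \is d.-homog ->
  divides q g -> ddir w g = 0 -> g = 0.
Proof.
move=> dq nzk hq hg dvd.
have nzq : q != 0.
  apply: contraNneq nzk => q0; move: dq; rewrite q0 linear0 => /esym/eqP.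
  by rewrite mpolyC_eq0.
case: d hg => [|d] hg; first by rewrite (divides_homog_lt hq hg).
move: hg; rewrite -addn1 => /(divides_homog hq)/(_ dvd)[h hh ->] {g dvd}.
suff main j a f : f \is j.-homog -> ddir w (f * q ^+ a.+1) = 0 -> f = 0.
  by rewrite -{1}[q]expr1 => /(main _ _ _ hh)->; rewrite mul0r.
elim: j a f => {h hh} [|j IH] a f hf; rewrite (ddirMXn _ _ dq) => /eqP;
  have nz : a.+1%:R * k != 0 by rewrite mulf_neq0 ?natS_neq0.
  rewrite ddir_homog0 // mul0r add0r mulf_eq0 expf_eq0 (negbTE nzq) andbF orbF.
  by rewrite scaler_eq0 (negbTE nz) => /eqP.
rewrite mulf_eq0 expf_eq0 (negbTE nzq) andbF orbF addr_eq0 => /eqP def_f.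
have def_f' : f = (- (a.+1%:R * k)^-1) *: (ddir w f * q).
  by rewrite def_f scalerN scaleNr opprK scalerA mulVf ?scale1r.
have df0 : ddir w f = 0.
  apply: (IH a.+1); first exact: ddir_homog.
  have := ddirMXn f a dq.
  rewrite def_f addNr mul0r {1}def_f' -scalerAl -mulrA -exprS linearZ /=.
  by move/eqP; rewrite scaler_eq0 oppr_eq0 invr_eq0 (negbTE nz) => /eqP.
by rewrite def_f' df0 mul0r scaler0.
Qed.

(** The derivations in the hypothesis span those that kill the linear form
    [p].  Euler's formula writes [g], up to a nonzero integer, as a combination of
    these derivatives and of [p] times [g^`M(i0)], and the induction applies
    to [g^`M(i0)] with the exponent lowered by one.  The bound on the degree
    is what excludes a power of [p] itself. *)
Lemma pow_linform_divides c i0 N d g :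
    c i0 = 1 -> g \is d.-homog -> (N <= d)%N ->
    (forall j, divides (linform c ^+ N) (g^`M(j) - c j *: g^`M(i0))) ->
  divides (linform c ^+ N) g.
Proof.
move=> ci0; elim: N d g => [|N IH] d g hg leNd dvd.
  by exists g; rewrite mulr1.
case: d hg leNd => // d hg leNd.
have dvd0 : divides (linform c ^+ N) g^`M(i0).
  apply: (IH d) => // [|j]; first exact: mderiv_homog.
  have [u def_u] := dvd j.
  have := congr1 (mderiv i0) def_u.
  rewrite mderivB mderivZ mderiv_comm => ->; rewrite mderivM.
  apply: dividesD; first by apply: dividesMl; exists (linform c); rewrite -exprS.
  apply: dividesMl.
  have E f : f^`M(i0) = ddir (fun i => (i == i0)%:R) f.
    rewrite /ddir (bigD1 i0) //= eqxx scale1r big1 ?addr0 // => i /negbTE->.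
    by rewrite scale0r.
  rewrite E (ddirXn _ (ddir_linform _ _)); apply: dividesZ; exact: divides_refl.
have e := euler_homog hg.
have {e}-> : g = (d.+1%:R)^-1 *:
    (\sum_j 'X_j * (g^`M(j) - c j *: g^`M(i0)) + g^`M(i0) * linform c).
  rewrite /linform mulr_sumr -big_split /=.
  have -> : \sum_(i < n) ('X_i * (g^`M(i) - c i *: g^`M(i0)) +
     g^`M(i0) * (c i *: 'X_i)) = \sum_(i < n) 'X_i * g^`M(i).
    by apply: eq_bigr => i _; rewrite -!mul_mpolyC; ring.
  by rewrite e scalerA mulVf ?natS_neq0 ?scale1r.
apply: dividesZ; apply: dividesD.
  by apply: divides_sum => j _; apply: dividesMl.
by rewrite mulrC exprS; case: dvd0 => u ->; exists u; rewrite mulrCA.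
Qed.

End CharZero.

(** * Linear substitutions *)

Section Substitution.
Variables (K : fieldType) (n : nat).
Local Notation R := {mpoly K[n]}.
Implicit Types (c : 'I_n -> K) (g h : R).

(** When the functional [c] maps the linear form [h] to [1], this is the
    projection along [h] onto the forms killed by [c]. *)
Definition subst_form c h g : R :=
  g \mPo [tuple 'X_i - c i *: h | i < n].

Lemma subst_form_is_linear c h : linear (subst_form c h).
Proof. by move=> a u v; rewrite /subst_form linearP. Qed.

Lemma subst_form_is_monoid_morphism c h : monoid_morphism (subst_form c h).
Proof. by split=> [|u v]; rewrite /subst_form ?rmorph1 ?rmorphM. Qed.

HB.instance Definition _ c h :=
  GRing.isLinear.Build K R R _ (subst_form c h) (subst_form_is_linear c h).
HB.instance Definition _ c h :=
  GRing.isMonoidMorphism.Build R R (subst_form c h)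
    (subst_form_is_monoid_morphism c h).

Lemma subst_formZ c h a g : subst_form c h (a *: g) = a *: subst_form c h g.
Proof. exact: linearZ. Qed.

Lemma subst_formX c h i : subst_form c h 'X_i = 'X_i - c i *: h.
Proof. by rewrite /subst_form comp_mpolyXU -tnth_nth tnth_mktuple. Qed.

Lemma subst_form_linform c h w :
  subst_form c h (linform w) = linform w - (\sum_i c i * w i) *: h.
Proof.
rewrite /linform (raddf_sum (subst_form c h)) scaler_suml -sumrB; apply: eq_bigr => i _.
by rewrite /= subst_formZ subst_formX scalerBr scalerA mulrC.
Qed.

Lemma subst_form_sub c h g : divides h (g - subst_form c h g).
Proof.
have dM a b : divides h (a - subst_form c h a) ->
    divides h (b - subst_form c h b) ->
    divides h (a * b - subst_form c h (a * b)).
  move=> [u def_u] [v def_v]; rewrite rmorphM /=.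
  exists (u * b + subst_form c h a * v).
  transitivity ((a - subst_form c h a) * b +
                subst_form c h a * (b - subst_form c h b)); first by ring.
  by rewrite def_u def_v; ring.
have dX i : divides h ('X_i - subst_form c h 'X_i : R).
  by rewrite subst_formX opprB addrCA subrr addr0; apply/dividesZ/divides_refl.
have d1 : divides h (1 - subst_form c h 1).
  by rewrite rmorph1 subrr; apply: divides0.
rewrite [g]mpolyE (raddf_sum (subst_form c h)) -sumrB /=; apply: divides_sum => m _.
rewrite subst_formZ -scalerBr; apply: dividesZ.
rewrite mpolyXE_id; elim/big_ind: _ => // i _.
by elim: (m i) => [|k IH]; rewrite ?expr0 // exprS; apply: dM.
Qed.

Lemma subst_form_homog c h d g : h \is 1.-homog -> g \is d.-homog ->
  subst_form c h g \is d.-homog.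
Proof.
move=> hh /dhomogP hg; rewrite [g]mpolyE (raddf_sum (subst_form c h)) big_seq /=.
apply: rpred_sum => m /hg dm; rewrite subst_formZ rpredZ //.
have {dm}<-: (\sum_i m i)%N = d by rewrite -mdegE.
rewrite mpolyXE_id rmorph_prod /=.
elim/big_ind2: _ => [|x1 x2 y1 y2|i _].
- exact: dhomog1.
- by move=> h1 h2; rewrite dhomogM.
rewrite rmorphXn /= subst_formX.
have h1 : 'X_i - c i *: h \is 1.-homog.
  by rewrite rpredB ?rpredZ // dhomogX /= mdeg1.
by have := dhomogMn (m i) h1; rewrite mul1n.
Qed.

End Substitution.

Section Restriction.
Variables (K : fieldType) (n : nat).
Local Notation R := {mpoly K[n]}.
Implicit Types (g h : R) (i j k : 'I_n).

Definition setX0 i : R -> R := subst_form (fun j => (j == i)%:R) 'X_i.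

Lemma setX0_is_linear i : linear (setX0 i).
Proof. by move=> a u v; rewrite /setX0 linearP. Qed.

Lemma setX0_is_monoid_morphism i : monoid_morphism (setX0 i).
Proof. by split=> [|u v]; rewrite /setX0 ?rmorph1 ?rmorphM. Qed.

HB.instance Definition _ i :=
  GRing.isLinear.Build K R R _ (setX0 i) (setX0_is_linear i).
HB.instance Definition _ i :=
  GRing.isMonoidMorphism.Build R R (setX0 i) (setX0_is_monoid_morphism i).

Lemma setX0Z i a g : setX0 i (a *: g) = a *: setX0 i g.
Proof. exact: linearZ. Qed.

Lemma setX0_var i j : setX0 i 'X_j = if j == i then 0 else 'X_j.
Proof.
rewrite /setX0 subst_formX; case: eqP => [->|_]; first by rewrite scale1r subrr.
by rewrite scale0r subr0.
Qed.

Lemma divides_setX0 i g : divides 'X_i g <-> setX0 i g = 0.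
Proof.
split=> [[u ->]|g0]; first by rewrite rmorphM /= setX0_var eqxx mulr0.
by have := subst_form_sub (fun j => (j == i)%:R) 'X_i g; rewrite -/(setX0 i g) g0 subr0.
Qed.

Lemma setX0_idem i g : setX0 i (setX0 i g) = setX0 i g.
Proof.
have [u def_u] := subst_form_sub (fun j => (j == i)%:R) 'X_i g.
have := congr1 (setX0 i) def_u; rewrite -/(setX0 i g) rmorphB rmorphM /=.
by rewrite setX0_var eqxx mulr0 => /eqP; rewrite subr_eq0 => /eqP.
Qed.

Lemma setX0_homog i d g : g \is d.-homog -> setX0 i g \is d.-homog.
Proof. by apply: subst_form_homog; rewrite dhomogX /= mdeg1. Qed.

Lemma mulX_inj i : injective (fun g : R => 'X_i * g).
Proof.
apply: mulfI; apply/eqP => /(congr1 (@mcoeff n K U_(i)%MM)) /eqP.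
by rewrite mcoeffX eqxx mcoeff0 oner_eq0.
Qed.

Lemma var_homog i : 'X_i \is [in K[n], 1.-homog].
Proof. by rewrite dhomogX /= mdeg1. Qed.

Lemma homog_mulX i d g : 'X_i * g \is d.+1.-homog -> g \is d.-homog.
Proof.
rewrite -addn1 => /(divides_homog (var_homog i))[|h hh /esym].
  by exists g; rewrite mulrC.
by rewrite mulrC => /mulX_inj <-.
Qed.

End Restriction.

(** * Homogeneous components of vectors *)

Section VectorComponents.
Variables (K : fieldType) (n : nat).
Local Notation R := {mpoly K[n]}.

(** The component of degree [e] of a vector of the graded free module with
    basis degrees [ds]. *)
Definition vcomp (ds : seq nat) e (v : 'rV[R]_(size ds)) : 'rV[R]_(size ds) :=
  \row_i (if (nth 0%N ds i <= e)%N then pihomog mdeg (e - nth 0%N ds i) (v 0 i) else 0).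

Variable ds : seq nat.
Implicit Types (u v : 'rV[R]_(size ds)).

Lemma vcomp_homog e v : ghomog e (vcomp e v).
Proof.
by move=> i; rewrite mxE; split=> h; [rewrite h pihomogP | rewrite leqNgt h].
Qed.

Lemma ghomog_vcomp e v : ghomog e v -> vcomp e v = v.
Proof.
move=> hv; apply/rowP => i; rewrite mxE; have [h1 h2] := hv i.
by case: leqP => h; [rewrite pihomog_dE ?h1 | rewrite h2].
Qed.

Lemma ghomogD e u v : ghomog e u -> ghomog e v -> ghomog e (u + v).
Proof.
move=> hu hv i; rewrite mxE; have [u1 u2] := hu i; have [v1 v2] := hv i.
by split=> h; [rewrite rpredD ?u1 ?v1 | rewrite u2 ?v2 ?addr0].
Qed.

Lemma ghomogN e v : ghomog e v -> ghomog e (- v).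
Proof.
move=> hv i; rewrite mxE; have [v1 v2] := hv i.
by split=> h; [rewrite rpredN v1 | rewrite v2 ?oppr0].
Qed.

Lemma vcompD e u v : vcomp e (u + v) = vcomp e u + vcomp e v.
Proof. by apply/rowP => i; rewrite !mxE; case: ifP; rewrite ?raddfD ?addr0. Qed.

Lemma vcompXS e i v : vcomp e.+1 ('X_i *: v) = 'X_i *: vcomp e v.
Proof.
apply/rowP => j; rewrite !mxE mulrC.
have h1 : 'X_i \is [in K[n], 1.-homog] by rewrite dhomogX /= mdeg1.
case: leqP => [le|lt]; last by rewrite leqNgt (ltn_trans _ lt) // mulr0.
case: leqP => [le'|lt'].
  by rewrite subSn // -addn1 (pihomogM _ _ h1) mulrC.
have -> : (e.+1 - nth 0%N ds j = 0)%N by lia.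
by rewrite (pihomogM_lt _ h1) // mulr0.
Qed.

Lemma vcompX0 i v : vcomp 0 ('X_i *: v) = 0.
Proof.
apply/rowP => j; rewrite !mxE mulrC; case: ifP => // _.
have h1 : 'X_i \is [in K[n], 1.-homog] by rewrite dhomogX /= mdeg1.
exact: (pihomogM_lt _ h1).
Qed.

Lemma vcomp_sum v : exists B, v = \sum_(e < B) vcomp e v.
Proof.
pose M := \max_(i < size ds) (mmeasure mdeg (v ord0 i) + nth 0%N ds i)%N.
exists M; apply/rowP => i; rewrite summxE.
have leM : (mmeasure mdeg (v ord0 i) + nth 0%N ds i <= M)%N.
  by rewrite /M (bigD1 i) //= leq_maxl.
under eq_bigr do rewrite mxE.
move: leM; set d := nth 0%N ds i => leM; clearbody d; clearbody M.
have e1 : v 0 i = \sum_(k < M) (if (d + k < M)%N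
    then pihomog mdeg k (v 0 i) else 0).
  rewrite -big_mkcond /=.
  have leM' : (M - d <= M)%N by rewrite leq_subr.
  rewrite {1}(@pihomog_partitionE _ _ mdeg (M - d) (v 0 i)); last first.
    by rewrite -[X in (X <= _)%N](addnK (d)); exact: leq_sub2r.
  rewrite (big_ord_widen _ (fun k : nat => pihomog mdeg k (v 0 i)) leM').
  apply: eq_bigl => k /=.
  by rewrite -ltn_subRL.
rewrite {1}e1 -(big_mkord predT (fun k => if (d + k < M)%N
    then pihomog mdeg k (v 0 i) else 0)).
rewrite -(big_mkord predT (fun e => if (d <= e)%N
    then pihomog mdeg (e - d) (v 0 i) else 0)).
have [lt|le] := ltnP (d) M; last first.
  rewrite !big_nat !big1 // => k /andP[_ h].
    by case: leqP => //; lia.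
  by case: ltnP => //; lia.
rewrite [RHS](@big_cat_nat _ _ _ (d)) //=; last exact: ltnW.
rewrite [X in _ = X + _]big_nat [X in _ = X + _]big1 ?add0r => [|k /andP[_ h]]; last first.
  by case: leqP => //; lia.
rewrite (_ : \sum_(d <= k < M) _ = \sum_(0 <= k < M - d)
    (if (d <= k + d)%N then pihomog mdeg (k + d - d) (v 0 i) else 0)); last first.
  by rewrite -(big_addn 0 M d predT (fun k => if (d <= k)%N
    then pihomog mdeg (k - d) (v 0 i) else 0)) add0n.
rewrite (@big_cat_nat _ _ _ (M - d)) //=; last exact: leq_subr.
rewrite [X in _ + X]big_nat [X in _ + X]big1 ?addr0 => [|k /andP[h1 h2]]; last first.
  by case: ltnP => //; lia.
rewrite big_nat [RHS]big_nat; apply: eq_bigr => k /andP[_ h].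
by rewrite leq_addl addnK ifT //; lia.
Qed.

End VectorComponents.

Section MatrixComponents.
Variables (K : fieldType) (n : nat) (ds : seq nat).
Local Notation R := {mpoly K[n]}.
Implicit Types (v : 'rV[R]_(size ds)).

Lemma vcompM ds' (A : 'M[R]_(size ds, size ds')) e v :
  (forall i : 'I_(size ds), ghomog (nth 0%N ds i)%N (row i A)) ->
  vcomp e (v *m A) = vcomp e v *m A.
Proof.
move=> hA; apply/rowP => j; rewrite !mxE.
rewrite (raddf_sum (pihomog mdeg _)) /=.
transitivity (\sum_i (if (nth 0%N ds' j <= e)%N
   then pihomog mdeg (e - nth 0%N ds' j) (v 0 i * A i j) else 0)).
  by case: ifP => // _; rewrite big1.
apply: eq_bigr => i _; rewrite mxE; have := hA i j; rewrite mxE => -[h1 h2].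
case: (leqP (nth 0%N ds' j) (nth 0%N ds i)) => [le|lt]; last first.
  by rewrite h2 // !mulr0 raddf0; case: ifP.
have {h1 h2} h := h1 le.
case: (leqP (nth 0%N ds i) e) => [le'|lt']; last first.
  case: (leqP _ e) => h0; last by rewrite mul0r.
  by rewrite mul0r (pihomogM_lt _ h) //; lia.
rewrite (leq_trans le le').
by rewrite -(pihomogM _ _ h); congr (pihomog _ _ _); lia.
Qed.

Lemma ghomog_mulmx ds' (A : 'M[R]_(size ds, size ds')) e v :
  (forall i : 'I_(size ds), ghomog (nth 0%N ds i)%N (row i A)) ->
  ghomog e v -> ghomog e (v *m A).
Proof.
by move=> hA hv; rewrite -(ghomog_vcomp hv) -(vcompM _ _ hA); apply: vcomp_homog.
Qed.

End MatrixComponents.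

(** * A freeness criterion for kernels over three variables *)

Section FreeKernel.
Variable K : fieldType.
Local Notation R := {mpoly K[3]}.

Variables (ds ds' : seq nat) (P : pred 'I_(size ds)).
Variable A : 'M[R]_(size ds, size ds').
Implicit Types (u v : 'rV[R]_(size ds)).

Definition supported v := forall l, ~~ P l -> v 0 l = 0.
Definition in_kernel v := supported v /\ v *m A = 0.

Lemma supportedD u v : supported u -> supported v -> supported (u + v).
Proof. by move=> hu hv l nP; rewrite mxE hu ?hv ?addr0. Qed.

Lemma supportedZ (a : R) v : supported v -> supported (a *: v).
Proof. by move=> hv l nP; rewrite mxE hv ?mulr0. Qed.

Lemma in_kernelD u v : in_kernel u -> in_kernel v -> in_kernel (u + v).
Proof.
by move=> [su ku] [sv kv]; split; rewrite ?mulmxDl ?ku ?kv ?addr0 //; apply: supportedD.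
Qed.

Lemma in_kernelZ (a : R) v : in_kernel v -> in_kernel (a *: v).
Proof.
by move=> [sv kv]; split; rewrite -?scalemxAl ?kv ?scaler0 //; apply: supportedZ.
Qed.

Lemma in_kernel_rows r (S : 'M[R]_(r, size ds)) (a : 'rV[R]_r) :
  (forall i, in_kernel (row i S)) -> in_kernel (a *m S).
Proof.
move=> hS; rewrite mulmx_sum_row; elim/big_ind: _ => [||i _].
- by split=> [l|]; rewrite ?mxE ?mul0mx.
- exact: in_kernelD.
- exact: in_kernelZ.
Qed.

Lemma divides_row m (a : R) (v : 'rV[R]_m) : (forall l, divides a (v 0 l)) ->
  exists w : 'rV[R]_m, v = a *: w /\ (forall l, v 0 l = 0 -> w 0 l = 0).
Proof.
move=> dv.
have /fin_all_exists[w hw] l : exists w : R, v 0 l = w * a /\ (v 0 l = 0 -> w = 0).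
  have [v0|nz] := eqVneq (v 0 l) 0; first by exists 0; rewrite mul0r.
  by have [w def_w] := dv l; exists w; split=> // v0; rewrite v0 eqxx in nz.
exists (\row_l w l); split.
  by apply/rowP => l; rewrite !mxE (hw l).1 mulrC.
by move=> l /(hw l).2; rewrite mxE.
Qed.

Lemma scaleX_inj m i : injective (fun v : 'rV[R]_m => 'X_i *: v).
Proof.
move=> u v /rowP eq_uv; apply/rowP => l; apply: (@mulX_inj _ _ i).
by have := eq_uv l; rewrite !mxE.
Qed.

Variables i j k : 'I_3.
Hypothesis ijk : [/\ i != j, i != k & j != k].

(* The cokernel has no [X_i]-torsion; this is so in particular when the image
   is itself the kernel of a matrix. *)
Hypothesis image_saturated : forall (c : 'rV[R]_(size ds')) u,
  supported u -> 'X_i *: c = u *m A -> exists2 w, supported w & c = w *m A.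

Lemma in_kernel_divX v (w : 'rV[R]_(size ds)) l : in_kernel v -> v = 'X_l *: w ->
  supported w -> in_kernel w.
Proof.
move=> [_ kv] def_v sw; split=> //; apply: (@scaleX_inj _ l).
by rewrite scaler0 scalemxAl -def_v.
Qed.

(** [X_i, X_j] is a regular sequence on the kernel. *)
Lemma kernel_regular2 s t : in_kernel s -> in_kernel t -> 'X_j *: s = 'X_i *: t ->
  exists2 w, in_kernel w & s = 'X_i *: w.
Proof.
move=> ks kt eq_st; have [l|w [def_s sw]] := @divides_row _ 'X_i s.
  apply/divides_setX0; have /rowP/(_ l) := eq_st.
  rewrite !mxE => /(congr1 (setX0 i)); rewrite !rmorphM /= !setX0_var eqxx.
  rewrite ifN_eqC; last by case: ijk.
  rewrite mul0r => /eqP; rewrite mulf_eq0 => /orP[/eqP X0|/eqP//].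
  have := @mulX_inj K 3 j; move/(_ 1 0); rewrite X0 !mul0r => /(_ erefl)/eqP.
  by rewrite oner_eq0.
exists w => //; apply: in_kernel_divX def_s _ => // l nP; apply: sw; exact: ks.1.
Qed.

(** [X_k] is regular modulo [X_i, X_j] on the kernel: this is where the
    saturation of the image enters, through the Koszul relation between
    [X_i] and [X_j]. *)
Lemma kernel_regular3 s t1 t2 : in_kernel s -> in_kernel t1 -> in_kernel t2 ->
    'X_k *: s = 'X_i *: t1 + 'X_j *: t2 ->
  exists w1 w2, [/\ in_kernel w1, in_kernel w2 & s = 'X_i *: w1 + 'X_j *: w2].
Proof.
have [ne_ij ne_ik ne_jk] := ijk.
have vi (v : 'rV[R]_(size ds)) (l : 'I_3) :
    exists w, v - map_mx (setX0 l) v = 'X_l *: w /\ forall e, v 0 e = 0 -> w 0 e = 0.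
  have [e|w [def_w sw]] := @divides_row _ 'X_l (v - map_mx (setX0 l) v).
    by rewrite !mxE; apply: subst_form_sub.
  by exists w; split=> // e ve0; apply: sw; rewrite !mxE ve0 rmorph0 subr0.
move=> ks kt1 kt2 eq_s.
have [a [def_a sa]] := vi s i.
have [b [def_b sb]] := vi (map_mx (setX0 i) s) j.
have s00 : map_mx (setX0 j) (map_mx (setX0 i) s) = 0.
  apply: (@scaleX_inj _ k); rewrite scaler0.
  apply/rowP => l; have /rowP/(_ l) := eq_s; rewrite !mxE.
  move/(congr1 (setX0 j \o setX0 i)); rewrite /= !rmorphD !rmorphM /=.
  rewrite !setX0_var !eqxx !(ifN_eqC _ _ ne_ik) !(ifN_eqC _ _ ne_ij).
  rewrite rmorph0 !setX0_var eqxx.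
  by rewrite !(ifN_eqC _ _ ne_jk) !mul0r addr0.
have supa : supported a by move=> l nP; apply: sa; apply: ks.1.
have supb : supported b.
  by move=> l nP; apply: sb; rewrite mxE ks.1 // rmorph0.
have def_s : s = 'X_i *: a + 'X_j *: b.
  by rewrite -def_a -def_b s00 subr0 subrK.
have kA : 'X_i *: (a *m A) = - ('X_j *: (b *m A)).
  by apply/eqP; rewrite -addr_eq0 !scalemxAl -mulmxDl -def_s ks.2.
have [l|c [def_c _]] := @divides_row _ 'X_i (b *m A).
  apply/divides_setX0; have /rowP/(_ l) := kA; rewrite !mxE.
  move/(congr1 (setX0 i)); rewrite rmorphN !rmorphM /= !setX0_var eqxx.
  rewrite (ifN_eqC _ _ ne_ij) mul0r => /esym/eqP; rewrite oppr_eq0 => /eqP h.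
  by apply: (@mulX_inj _ _ j); rewrite mulr0.
have [w sw def_cw] := image_saturated supb (esym def_c).
have ka : a *m A = - ('X_j *: c).
  apply: (@scaleX_inj _ i); rewrite kA def_c scalerN; congr (- _).
  by rewrite !scalerA mulrC.
exists (a + 'X_j *: w), (b - 'X_i *: w); split.
- split; first exact/supportedD/supportedZ.
  by rewrite mulmxDl ka -scalemxAl -def_cw addNr.
- split; first by apply: supportedD => //; rewrite -scaleNr; apply: supportedZ.
  by rewrite mulmxBl def_c -scalemxAl -def_cw subrr.
- rewrite {1}def_s scalerDr scalerBr !scalerA (mulrC (mpolyX K U_(j)) (mpolyX K U_(i))).
  by rewrite -addrA; congr (_ + _); rewrite addrC subrK.
Qed.

Hypothesis A_homog : forall l : 'I_(size ds), ghomog (nth 0%N ds l) (row l A).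

Lemma in_kernel_vcomp e v : in_kernel v -> in_kernel (vcomp e v).
Proof.
move=> [sv kv]; split=> [l nP|]; first by rewrite mxE sv // raddf0 if_same.
by rewrite -vcompM // kv; apply/rowP => l; rewrite !mxE raddf0 if_same.
Qed.

Variables (es : seq nat) (N : nat).
Hypothesis es_const : forall l : 'I_(size es), nth 0%N es l = N.

(* [D] is only linear over the field: it will be an iterated derivative. *)
Variable D : 'rV[R]_(size ds) -> 'rV[R]_(size es).
Hypothesis D_add : forall u v, D (u + v) = D u + D v.
Hypothesis D_scale : forall (c : K) v, D (c%:MP *: v) = c%:MP *: D v.
Hypothesis D_homog : forall d v, in_kernel v -> ghomog (N + d) v ->
  forall l, D v 0 l \is d.-homog.
Hypothesis D_low : forall e v, in_kernel v -> ghomog e v -> (e < N)%N -> D v = 0.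
Hypothesis D_inj : forall e v, in_kernel v -> ghomog e v -> D v = 0 -> v = 0.

Variable S : 'M[R]_(size es, size ds).
Hypothesis S_kernel : forall l, in_kernel (row l S).
Hypothesis S_homog : forall l, ghomog N (row l S).
Hypothesis D_S : forall l, D (row l S) = delta_mx 0 l.

Lemma kernel_low e v : in_kernel v -> ghomog e v -> (e < N)%N -> v = 0.
Proof. by move=> kv hv lt; apply: (D_inj kv hv); apply: D_low kv hv lt. Qed.

Lemma D_zero : D 0 = 0.
Proof.
by rewrite -(scale0r (0 : 'rV_(size ds))) -mpolyC0 D_scale mpolyC0 scale0r.
Qed.

Lemma D_comb (g : 'rV[K]_(size es)) :
  D (map_mx (@mpolyC 3 K) g *m S) = map_mx (@mpolyC 3 K) g.
Proof.
rewrite mulmx_sum_row (big_morph D D_add D_zero) [RHS]row_sum_delta.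
by apply: eq_bigr => l _; rewrite mxE D_scale D_S.
Qed.

Lemma ghomog_rows d (a : 'rV[R]_(size es)) :
  ghomog (N + d) a <-> forall l, a 0 l \is d.-homog.
Proof.
split=> [ha l|ha l]; last by rewrite es_const leq_addr addKn ltnNge leq_addr.
by have := (ha l).1; rewrite es_const leq_addr addKn; apply.
Qed.

(** The left hand side has degree [N], and the kernel vanishes in degree
    [N - 1], where the components of [w1] and [w2] would have to lie. *)
Lemma lowest_independent (g : 'rV[K]_(size es)) (w1 w2 : 'rV[R]_(size ds)) :
    in_kernel w1 -> in_kernel w2 ->
  map_mx (@mpolyC 3 K) g *m S = 'X_i *: w1 + 'X_j *: w2 -> g = 0.
Proof.
move=> k1 k2 eq_g; suff S0 : map_mx (@mpolyC 3 K) g *m S = 0.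
  have := D_comb g; rewrite S0 => e0; apply/rowP => l; rewrite mxE.
  have /rowP/(_ l) := e0; rewrite D_zero !mxE => /esym/eqP.
  by rewrite mpolyC_eq0 => /eqP.
have hS : ghomog (N + 0) (map_mx (@mpolyC 3 K) g *m S).
  apply: ghomog_mulmx => [l|]; first by rewrite es_const.
  by apply/ghomog_rows => l; rewrite mxE -[_%:MP]mulr1 mul_mpolyC rpredZ ?dhomog1.
rewrite addn0 in hS; rewrite -(ghomog_vcomp hS) eq_g vcompD.
case def_N: N => [|M]; first by rewrite !vcompX0 addr0.
have low w : in_kernel w -> vcomp M w = 0.
  move=> kw; apply: (@kernel_low M); first exact: in_kernel_vcomp.
    exact: vcomp_homog.
  by rewrite def_N.
by rewrite !vcompXS !low ?scaler0 ?addr0.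
Qed.

Lemma restrict_pow d (a : R) : a \is d.-homog ->
  exists c : K, setX0 j (setX0 i a) = c%:MP * 'X_k ^+ d.
Proof.
move=> /dhomogP ha; pose f (l : 'I_3) : K := ((l != i) && (l != j))%:R.
exists (\sum_(m <- msupp a) a@_m * \prod_l f l ^+ m l).
rewrite {1}[a]mpolyE (raddf_sum (setX0 i)) /= (raddf_sum (setX0 j)) /=.
rewrite (raddf_sum (@mpolyC 3 K)) mulr_suml /=.
rewrite big_seq [RHS]big_seq; apply: eq_bigr => m /ha dm.
rewrite !setX0Z rmorphM /= -mulrA mul_mpolyC; congr (_ *: _).
have {dm}<-: (\sum_l m l)%N = d by rewrite -mdegE.
rewrite mpolyXE_id !rmorph_prod /= -prodrXr -big_split /=.
apply: eq_bigr => l _; rewrite !rmorphXn /= -exprMn; congr (_ ^+ _).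
rewrite setX0_var /f; case: eqVneq => [|ne_li]; first by rewrite rmorph0 mul0r.
rewrite setX0_var; case: eqVneq => [|ne_lj]; first by rewrite mul0r.
rewrite mul1r; congr (mpolyX _ (mnm1 _)); apply/val_inj => /=.
have [ne_ij ne_ik ne_jk] := ijk.
move: ne_ij ne_ik ne_jk ne_li ne_lj; rewrite -!val_eqE /=.
by move: (ltn_ord i) (ltn_ord j) (ltn_ord k) (ltn_ord l); lia.
Qed.

(** Modulo [X_i] and [X_j] the coefficients are constants times a power of
    [X_k], which is regular on the kernel modulo [X_i] and [X_j]. *)
Lemma modX_divides d (b : 'rV[R]_(size es)) t :
    (forall l, b 0 l \is d.-homog) -> (forall l, setX0 i (b 0 l) = b 0 l) ->
  in_kernel t -> b *m S = 'X_i *: t -> forall l, setX0 j (b 0 l) = 0.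
Proof.
move=> hb bi kt eq_b.
have /fin_all_exists[g hg0] l := restrict_pow (hb l).
have hg l : setX0 j (b 0 l) = (g l)%:MP * 'X_k ^+ d by rewrite -(bi l) hg0.
have [l|b' [def_b _]] := @divides_row _ 'X_j (b - map_mx (setX0 j) b).
  by rewrite !mxE; apply: subst_form_sub.
pose G : 'rV[K]_(size es) := \row_l g l.
have eq_G : 'X_k ^+ d *: (map_mx (@mpolyC 3 K) G *m S) =
    'X_i *: t + 'X_j *: (- (b' *m S)).
  rewrite -eq_b scalerN !scalemxAl -def_b mulmxBl opprB addrC subrK.
  by congr (_ *m S); apply/rowP => l; rewrite !mxE hg mulrC.
have kG : in_kernel (map_mx (@mpolyC 3 K) G *m S) by apply: in_kernel_rows.
have kNb' : in_kernel (- (b' *m S)).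
  by rewrite -scaleN1r; apply/in_kernelZ/in_kernel_rows.
have pw m u1 u2 : in_kernel u1 -> in_kernel u2 ->
    'X_k ^+ m *: (map_mx (@mpolyC 3 K) G *m S) = 'X_i *: u1 + 'X_j *: u2 -> G = 0.
  elim: m u1 u2 => [|m IHm] u1 u2 k1 k2.
    by rewrite expr0 scale1r; exact: lowest_independent.
  rewrite exprS -scalerA => /kernel_regular3[]//; first exact: in_kernelZ.
  by move=> w1 [w2 [kw1 kw2]]; apply: IHm.
have /rowP G0 := pw _ _ _ kt kNb' eq_G.
by move=> l; have := G0 l; rewrite hg !mxE => ->; rewrite mpolyC0 mul0r.
Qed.

Lemma independent_modX d (b : 'rV[R]_(size es)) t :
    (forall l, b 0 l \is d.-homog) -> (forall l, setX0 i (b 0 l) = b 0 l) ->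
  in_kernel t -> b *m S = 'X_i *: t -> b = 0.
Proof.
have [ne_ij _ _] := ijk.
elim: d b t => [|d IH] b t hb bi kt eq_b; have bj := modX_divides hb bi kt eq_b.
  apply/rowP => l; rewrite [RHS]mxE.
  by apply: (divides_homog_lt (var_homog K j) (hb l)) => //; apply/divides_setX0/bj.
have [l|b' [def_b _]] := @divides_row _ 'X_j b; first exact/divides_setX0.
have Eb l : b 0 l = 'X_j * b' 0 l by rewrite def_b !mxE.
have hb' l : b' 0 l \is d.-homog by apply: (@homog_mulX _ _ j); rewrite -Eb.
have bi' l : setX0 i (b' 0 l) = b' 0 l.
  apply: (@mulX_inj _ _ j); rewrite -Eb -(bi l) Eb rmorphM /= setX0_var.
  by rewrite (ifN_eqC _ _ ne_ij).
have kb' : in_kernel (b' *m S) by apply: in_kernel_rows.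
have eq_b' : 'X_j *: (b' *m S) = 'X_i *: t by rewrite scalemxAl -def_b.
have [w kw eq_w] := kernel_regular2 kb' kt eq_b'.
by rewrite def_b (IH b' w) ?scaler0.
Qed.

(** The part of the coefficients free of [X_i] vanishes by
    [independent_modX]; what is left can be divided by [X_i]. *)
Lemma rows_independent_homog d (a : 'rV[R]_(size es)) :
  (forall l, a 0 l \is d.-homog) -> a *m S = 0 -> a = 0.
Proof.
elim: d a => [|d IH] a ha a0.
all: have [l|a' [def_a _]] := @divides_row _ 'X_i (a - map_mx (setX0 i) a);
  first by rewrite !mxE; apply: subst_form_sub.
all: have b0 : map_mx (setX0 i) a = 0.
1,3: apply: (@independent_modX _ _ (- (a' *m S))) => [l|l||];
   rewrite ?mxE ?setX0_idem //; [exact: setX0_homog (ha l) |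
   by rewrite -scaleN1r; apply/in_kernelZ/in_kernel_rows |
   by rewrite scalerN scalemxAl -def_a mulmxBl a0 sub0r opprK].
all: rewrite b0 subr0 in def_a.
  apply/rowP => l; rewrite mxE; apply: (divides_homog_lt (var_homog K i) (ha l)) => //.
  by exists (a' 0 l); rewrite def_a !mxE mulrC.
have Ea l : a 0 l = 'X_i * a' 0 l by rewrite def_a !mxE.
rewrite def_a (IH a') ?scaler0 // => [l|].
  by apply: (@homog_mulX _ _ i); rewrite -Ea.
by apply: (@scaleX_inj _ i); rewrite scaler0 scalemxAl -def_a.
Qed.

Lemma rows_independent (a : 'rV[R]_(size es)) : a *m S = 0 -> a = 0.
Proof.
move=> a0; have [B ->] := vcomp_sum a; apply: big1 => e _.
have h := vcomp_homog e a.
have eS : vcomp e a *m S = 0.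
  rewrite -vcompM ?a0 => [|l]; last by rewrite es_const.
  by apply/rowP => l; rewrite !mxE raddf0 if_same.
have [lt|le] := ltnP e N.
  by apply/rowP => l; rewrite !mxE es_const leqNgt lt.
apply: (@rows_independent_homog (e - N)) => //.
by apply/ghomog_rows; rewrite subnKC.
Qed.

(** Generation by a dimension count: a homogeneous kernel element and the
    coefficients that should produce it live in the same finite-dimensional
    space, on which [D] after [mulmx S] is injective. *)
Lemma rows_generate_homog d v : in_kernel v -> ghomog (N + d) v ->
  exists2 a : 'rV[R]_(size es), (forall l, a 0 l \is d.-homog) & v = a *m S.
Proof.
move=> kv hv; pose T := {ffun 'I_(size es) -> dhomog 2.+1 K d}.
pose vec (a : T) : 'rV[R]_(size es) := \row_l (a l : R).
have vecD c a b : vec (c *: a + b) = c%:MP *: vec a + vec b.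
  by apply/rowP => l; rewrite !mxE !ffunE mul_mpolyC.
pose F (a : T) : T := [ffun l => @indhomog 2.+1 K d (D (vec a *m S) 0 l)].
have hvec a : ghomog (N + d) (vec a *m S).
  apply: ghomog_mulmx => [l|]; first by rewrite es_const.
  by apply/ghomog_rows => l; rewrite mxE; apply: dhomog_is_dhomog.
have kvec a : in_kernel (vec a *m S) by apply: in_kernel_rows.
have FE a l : (F a l : R) = D (vec a *m S) 0 l.
  rewrite ffunE /indhomog; apply: insubdK; exact: (D_homog (kvec a) (hvec a)).
clearbody F; have Flin : linear F.
  move=> c a b; apply/ffunP => l; apply/val_inj; rewrite [in RHS]ffunE [in RHS]ffunE.
  apply: etrans (FE (c *: a + b) l) _; rewrite vecD mulmxDl -scalemxAl D_add D_scale.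
  by rewrite mxE [X in X + _]mxE -!FE mul_mpolyC.
pose FL : {linear T -> T} := HB.pack F (GRing.isLinear.Build K T T _ F Flin).
have FLE a : linfun FL a = F a by rewrite lfunE.
have inj : lker (linfun FL) == 0%VS.
  apply/lker0P => a b; rewrite !FLE => eqF.
  have eq0 : F (a - b) = 0.
    by rewrite addrC -scaleN1r Flin eqF scaleN1r addNr.
  have v0 : vec (a - b) *m S = 0.
    apply: (D_inj (kvec _) (hvec _)); apply/rowP => l.
    by rewrite -FE eq0 ffunE mxE.
  have /rowP z := rows_independent v0.
  apply/ffunP => l; apply/val_inj/eqP; rewrite -subr_eq0.
  by have := z l; rewrite !mxE !ffunE => <-.
have : [ffun l => @indhomog 2.+1 K d (D v 0 l)] \in limg (linfun FL).
  by rewrite lker0_limgf ?memvf.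
case/memv_imgP => a _; rewrite FLE => /ffunP eqF.
exists (vec a) => [l|]; first by rewrite mxE; apply: dhomog_is_dhomog.
have NvS : - (vec a *m S) = (-1)%:MP *: (vec a *m S) by rewrite mpolyCN scaleN1r.
have kd : in_kernel (v - vec a *m S).
  by apply: in_kernelD => //; rewrite NvS; apply: in_kernelZ.
have hd : ghomog (N + d) (v - vec a *m S). by apply: ghomogD => //; apply: ghomogN.
apply/eqP; rewrite -subr_eq0; apply/eqP; apply: (D_inj kd hd).
rewrite NvS D_add D_scale mpolyCN scaleN1r; apply/rowP => l.
have := congr1 (@mpoly_of_dhomog _ _ _) (eqF l).
rewrite FE ffunE /indhomog insubdK; last exact: (D_homog kv hv).
by rewrite !mxE => ->; rewrite subrr.
Qed.

Lemma free_kernel e v : in_kernel v -> ghomog e v ->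
  exists2 a : 'rV[R]_(size es), ghomog e a & v = a *m S.
Proof.
move=> kv hv; have [lt|le] := ltnP e N.
  exists 0; last by rewrite mul0mx (kernel_low kv hv).
  by move=> l; rewrite mxE dhomog0.
move: hv; rewrite -(subnKC le) => hv.
have [a ha ->] := rows_generate_homog kv hv; exists a => //.
exact/ghomog_rows.
Qed.

End FreeKernel.

(** * The arrangement: seven points on six lines *)

Definition line_coefs : seq (seq int) :=
  [:: [:: 1; 0; 0]; [:: 0; 1; 0]; [:: 0; 0; 1];
      [:: 1; -1; 0]; [:: 1; 0; -1]; [:: 0; 1; -1]].

Definition point_coefs : seq (seq int) :=
  [:: [:: 1; 0; 0]; [:: 0; 1; 0]; [:: 0; 0; 1];
      [:: 1; 1; 0]; [:: 1; 0; 1]; [:: 0; 1; 1]; [:: 1; 1; 1]].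

Definition line_coef (e i : nat) : int := nth 0 (nth [::] line_coefs e) i.
Definition point_coef (p i : nat) : int := nth 0 (nth [::] point_coefs p) i.

Definition pairing (e p : nat) : int :=
  line_coef e 0 * point_coef p 0 + line_coef e 1 * point_coef p 1
  + line_coef e 2 * point_coef p 2.

Definition incident (e p : nat) : bool := pairing e p == 0.

Lemma ord_all n (f : pred nat) : all f (iota 0 n) -> forall i : 'I_n, f i.
Proof. by move/allP=> h i; apply: h; rewrite mem_iota /= add0n. Qed.

Lemma ord_has n (f : pred nat) : has f (iota 0 n) -> exists i : 'I_n, f i.
Proof.
by case/hasP=> i; rewrite mem_iota add0n => /andP[_ lt] fi; exists (Ordinal lt).
Qed.

Lemma pairing_unit (e : 'I_6) (p : 'I_7) :
  ~~ incident e p -> pairing e p = 1 \/ pairing e p = -1.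
Proof.
have /ord_all/(_ e)/ord_all/(_ p) : all (fun e => all (fun p =>
  incident e p || (pairing e p == 1) || (pairing e p == -1)) (iota 0 7)) (iota 0 6).
  by vm_compute.
by case/orP=> [/orP[->//|/eqP]|/eqP]; auto.
Qed.

Lemma meeting_point (e H : 'I_6) : e != H ->
  exists p0 : 'I_7, [/\ incident e p0, incident H p0 &
    forall p : 'I_7, incident H p -> p != p0 -> ~~ incident e p].
Proof.
have /ord_all/(_ e)/ord_all/(_ H) : all (fun e => all (fun H => (e != H) ==>
  has (fun p0 => [&& incident e p0, incident H p0 &
    all (fun p => incident H p ==> (p != p0) ==> ~~ incident e p) (iota 0 7)])
  (iota 0 7)) (iota 0 6)) (iota 0 6).
  by vm_compute.
move=> /implyP h ne; case/ord_has: (h ne) => p0 /and3P[h1 h2 /ord_all h3].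
by exists p0; split=> // p hp nep; move/implyP: (h3 p) => /(_ hp)/implyP; apply.
Qed.

Definition unit_ints : seq int := [:: 0; 1; -1].

(** Two lines through a point span its annihilator, with integer coefficients. *)
Lemma annihilator_span (e H : 'I_6) (p : 'I_7) :
    e != H -> incident e p -> incident H p ->
  exists2 i0 : 'I_3, point_coef p i0 = 1 &
    forall j : 'I_3, exists a b : int, forall i : 'I_3,
      (j == i)%:R - point_coef p j * (i0 == i)%:R
        = a * line_coef e i + b * line_coef H i.
Proof.
have /ord_all/(_ e)/ord_all/(_ H)/ord_all/(_ p) :
  all (fun e => all (fun H => all (fun p =>
    (e != H) ==> incident e p ==> incident H p ==>
    has (fun i0 => (point_coef p i0 == 1) &&
      all (fun j => has (fun a => has (fun b => all (fun i =>
        (j == i)%:R - point_coef p j * (i0 == i)%:R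
          == a * line_coef e i + b * line_coef H i) (iota 0 3))
        unit_ints) unit_ints) (iota 0 3)) (iota 0 3))
    (iota 0 7)) (iota 0 6)) (iota 0 6).
  by vm_compute.
move=> /implyP h ne /(implyP (h ne)) /implyP h' /h'.
case/ord_has=> i0 /andP[/eqP p1 /ord_all h3].
exists i0 => // j; have /hasP[a _ /hasP[b _ /ord_all hi]] := h3 j.
by exists a, b => i; apply/eqP; apply: hi.
Qed.

(** * Flows along a line *)

Section Flows.
Variable K : fieldType.
Hypothesis charK : [pchar K] =i pred0.
Local Notation R := {mpoly K[3]}.
Implicit Types (e H : 'I_6) (p q : 'I_7) (m : seq 'I_6) (s S G : 'I_7 -> R).

Definition ell e (i : 'I_3) : K := (line_coef e i)%:~R.
Definition point p : R := linform (fun i : 'I_3 => (point_coef p i)%:~R).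
Definition cut m (a : nat) : nat := count (fun e : 'I_6 => ~~ incident e a) m.

Lemma point_homog p : point p \is 1.-homog.
Proof. exact: linform_homog. Qed.

Lemma ddir_point e p : ddir (ell e) (point p) = ((pairing e p)%:~R)%:MP.
Proof.
rewrite ddir_linform; congr (_%:MP).
by rewrite !big_ord_recl big_ord0 addr0 /= /pairing !rmorphD !rmorphM /= addrA.
Qed.

Lemma pairing_neq0 e p : ~~ incident e p -> (pairing e p)%:~R != 0 :> K.
Proof.
by case/pairing_unit=> ->; rewrite ?rmorphN ?oppr_eq0 rmorph1 oner_eq0.
Qed.

Lemma point_neq0 p : point p != 0.
Proof.
have /ord_all/(_ p)/ord_has[e] : all (fun b => has (fun a => ~~ incident a b)
  (iota 0 6)) (iota 0 7).
  by vm_compute.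
move/pairing_neq0; apply: contraNneq => p0.
by move: (ddir_point e p); rewrite p0 ddir0 => /esym/eqP; rewrite mpolyC_eq0.
Qed.

Definition homog_fun d s : Prop := forall p, s p \is d.-homog.

(** The products of a syzygy, supported on [H], with the powers of the points. *)
Definition line_flow m H s : Prop :=
  [/\ forall p, ~~ incident H p -> s p = 0, \sum_p s p = 0
    & forall p, divides (point p ^+ cut m p) (s p)].

Lemma ddir_divides_cut e m p (g : R) :
  divides (point p ^+ cut (e :: m) p) g ->
  divides (point p ^+ cut m p) (ddir (ell e) g).
Proof.
rewrite /cut /= => -[u ->]; have [i|i] := boolP (incident e p); rewrite /= ?add0n ?add1n.
  case: (count _ _) => [|c].
    by exists (ddir (ell e) (u * point p ^+ 0)); rewrite expr0 !mulr1.
  rewrite (ddirMXn _ _ (ddir_point e p)).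
  move/eqP: i => ->; rewrite mulr0 scale0r addr0 -mulrA -exprS.
  by exists (ddir (ell e) u).
rewrite (ddirMXn _ _ (ddir_point e p)); set c := count _ _.
by exists (ddir (ell e) u * point p + (c.+1%:R * (pairing e p)%:~R) *: u).
Qed.

Lemma ddir_homogB e d (g : R) : g \is d.-homog -> ddir (ell e) g \is d.-1.-homog.
Proof.
by case: d => [|d] hg; [rewrite ddir_homog0 // dhomog0 | exact: ddir_homog].
Qed.

Lemma ddir_line_flow e m H s : line_flow (e :: m) H s ->
  line_flow m H (fun p => ddir (ell e) (s p)).
Proof.
case=> h1 h2 h3; split=> [p /h1->||p]; first by rewrite ddir0.
  by rewrite -ddir_sum h2 ddir0.
exact: ddir_divides_cut.
Qed.

Lemma cut_line H m p : incident H p -> cut (H :: m) p = cut m p.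
Proof. by rewrite /cut /= => ->. Qed.

Lemma line_flow_line H m s : line_flow m H s <-> line_flow (H :: m) H s.
Proof.
by split=> -[h1 h2 h3]; split=> // p; have [i|/h1->] := boolP (incident H p);
  try exact: divides0; have := h3 p; rewrite cut_line.
Qed.

Lemma sum_eq0_last (I : finType) (F : I -> R) i0 :
  \sum_i F i = 0 -> (forall i, i != i0 -> F i = 0) -> F i0 = 0.
Proof. by rewrite (bigD1 i0) //= => + h; rewrite big1 ?addr0. Qed.

(** Off [e] each component is divisible by its point, hence determined by
    its derivative; the component at the one remaining point is determined by
    the vanishing of the sum. *)
Lemma line_flow_inj e H d s : e != H -> homog_fun d s ->
    (forall p, ~~ incident H p -> s p = 0) -> \sum_p s p = 0 ->
    (forall p, incident H p -> ~~ incident e p -> divides (point p) (s p)) ->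
  (forall p, ddir (ell e) (s p) = 0) -> forall p, s p = 0.
Proof.
move=> neH hs supp sum0 dvd ds.
have [p0 [ep0 Hp0 off]] := meeting_point neH.
have s0 p : p != p0 -> s p = 0.
  have [Hp|/supp//] := boolP (incident H p); move/(off p Hp) => nep.
  exact: (ddir_inj charK (ddir_point e p) (pairing_neq0 nep) (point_homog p)
    (hs p) (dvd _ Hp nep)).
move=> p; have [->|/s0//] := eqVneq p p0.
exact: (sum_eq0_last sum0 s0).
Qed.

Lemma divides_cut_point e m p (g : R) : ~~ incident e p ->
  divides (point p ^+ cut (e :: m) p) g -> divides (point p) g.
Proof.
by move=> nep dv; rewrite -[point p]expr1; apply: dividesX dv; rewrite /cut /= nep.
Qed.

(** Differentiating along the lines of [m] other than [H] lowers the degree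
    and loses nothing, so there is nothing below the number of such lines. *)
Lemma line_flow_low m H d s : line_flow m H s -> homog_fun d s ->
  (d < count (predC1 H) m)%N -> forall p, s p = 0.
Proof.
elim: m d s => [|e m IH] d s //= fs hs.
have [eH|neH] := eqVneq e H.
  by rewrite /= add0n => lt; apply: IH lt => //; apply/line_flow_line; rewrite -{1}eH.
rewrite /= add1n ltnS => lt.
have ds p : ddir (ell e) (s p) = 0.
  case: d hs lt => [|d] hs lt; first by rewrite ddir_homog0.
  apply: (IH d (fun p => ddir (ell e) (s p))) => //; first exact: ddir_line_flow.
  by move=> q; apply: ddir_homog.
case: fs => h1 h2 h3; apply: (line_flow_inj neH hs) => // p _ nep.
exact: divides_cut_point (h3 p).
Qed.

Lemma cut_le_count m H p : incident H p -> (cut m p <= count (predC1 H) m)%N.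
Proof. by move=> Hp; apply: sub_count => e; apply: contraNneq => ->. Qed.

Lemma mderiv_span e H p : e != H -> incident e p -> incident H p ->
  exists2 i0 : 'I_3, (point_coef p i0)%:~R = 1 :> K &
    forall j : 'I_3, exists a b : K, forall g : R,
      g^`M(j) - (point_coef p j)%:~R *: g^`M(i0)
        = a *: ddir (ell e) g + b *: ddir (ell H) g.
Proof.
move=> neH ep Hp; have [i0 pi0 span] := annihilator_span neH ep Hp.
exists i0 => [|j]; first by rewrite pi0.
have [a [b hab]] := span j; exists a%:~R, b%:~R => g.
have E (i : 'I_3) : g^`M(i) = \sum_l ((i == l)%:R : K) *: g^`M(l).
  rewrite (bigD1 i) //= eqxx scale1r big1 ?addr0 // => l.
  by rewrite eq_sym => /negbTE->; rewrite scale0r.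
rewrite [g^`M(j)]E [g^`M(i0)]E /ddir !scaler_sumr -sumrB -big_split /=.
apply: eq_bigr => l _; rewrite !scalerA -scalerBl -scalerDl; congr (_ *: _).
have /(congr1 (fun x : int => x%:~R : K)) := hab l.
by rewrite rmorphB !rmorphM rmorphD !rmorphM /= !rmorph_nat.
Qed.

(** The key divisibility: the value of the antiderivative at the meeting
    point of [e] and [H], which is only known to be minus the sum of the
    others, has both its [e]- and its [H]-derivative divisible by the right
    power. *)
Lemma lift_divides e H m d s S p0 : e != H -> incident e p0 -> incident H p0 ->
    (forall p, incident H p -> p != p0 -> ~~ incident e p) ->
    line_flow m H s -> homog_fun d s -> homog_fun d.+1 S ->
    (forall p, ~~ incident H p -> S p = 0) -> \sum_p S p = 0 ->
    (forall p, ddir (ell e) (S p) = s p) ->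
    (forall p, p != p0 -> divides (point p ^+ cut (e :: m) p) (S p)) ->
  divides (point p0 ^+ cut m p0) (S p0).
Proof.
move=> neH ep0 Hp0 off.
have inj d' T : homog_fun d' T -> (forall p, ~~ incident H p -> T p = 0) ->
    \sum_p T p = 0 ->
    (forall p, p != p0 -> divides (point p ^+ cut (e :: m) p) (T p)) ->
    (forall p, ddir (ell e) (T p) = 0) -> forall p, T p = 0.
  move=> hT suppT sumT dvdT; apply: (line_flow_inj neH hT suppT sumT) => p _ nep.
  apply: (divides_cut_point (m := m) nep); apply: dvdT.
  by apply: contraNneq nep => ->.
have dvdD T : (forall p, ~~ incident H p -> T p = 0) ->
    (forall p, p != p0 -> divides (point p ^+ cut (e :: m) p) (T p)) ->
    forall p, p != p0 -> divides (point p ^+ cut (e :: m) p) (ddir (ell H) (T p)).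
  move=> suppT dvdT p nep; have [i|/suppT->] := boolP (incident H p).
    by apply: ddir_divides_cut; rewrite cut_line //; apply: dvdT.
  by rewrite ddir0; apply: divides0.
have [i0 pi0 span] := mderiv_span neH ep0 Hp0.
have close d' s' S' : line_flow m H s' -> homog_fun d'.+1 S' ->
    (forall p, ddir (ell e) (S' p) = s' p) -> (cut m p0 <= d'.+1)%N ->
    divides (point p0 ^+ cut m p0) (ddir (ell H) (S' p0)) ->
    divides (point p0 ^+ cut m p0) (S' p0).
  move=> fs' hS' dS' le dvdH.
  apply: (pow_linform_divides charK (i0 := i0) _ (hS' p0) le); rewrite ?pi0 // => j.
  have [a [b ->]] := span j; apply: dividesD; apply: dividesZ => //.
  by rewrite dS'; case: fs' => _ _; apply.
have low d' s' S' : line_flow m H s' -> homog_fun d' s' -> homog_fun d'.+1 S' ->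
    (forall p, ~~ incident H p -> S' p = 0) -> \sum_p S' p = 0 ->
    (forall p, ddir (ell e) (S' p) = s' p) ->
    (forall p, p != p0 -> divides (point p ^+ cut (e :: m) p) (S' p)) ->
    (d'.+1 < cut m p0)%N -> divides (point p0 ^+ cut m p0) (S' p0).
  move=> fs' hs' hS' suppS' sumS' dS' dvdS' lt.
  rewrite (inj _ _ hS' suppS' sumS' dvdS'); first exact: divides0.
  move=> p; rewrite dS'; apply: (line_flow_low fs' hs').
  by apply: leq_trans (cut_le_count _ Hp0); apply: ltnW.
elim: d s S => [|d IH] s S fs hs hS suppS sumS dS dvdS.
  have [lt|le] := ltnP 1 (cut m p0); first exact: (low 0%N s).
  apply: (close 0%N s) => //.
  rewrite (inj 0%N (fun p => ddir (ell H) (S p))); first exact: divides0.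
  - by move=> p; apply: ddir_homog.
  - by move=> p /suppS->; rewrite ddir0.
  - by rewrite -ddir_sum sumS ddir0.
  - exact: dvdD.
  - by move=> p; rewrite ddirC dS ddir_homog0.
have [lt|le] := ltnP d.+2 (cut m p0); first exact: (low d.+1 s).
apply: (close d.+1 s) => //.
apply: (IH (fun p => ddir (ell H) (s p)) (fun p => ddir (ell H) (S p))).
- by apply: ddir_line_flow; apply: (proj1 (line_flow_line H m s)).
- by move=> p; apply: ddir_homog.
- by move=> p; apply: ddir_homog.
- by move=> p /suppS->; rewrite ddir0.
- by rewrite -ddir_sum sumS ddir0.
- by move=> p; rewrite ddirC dS.
- exact: dvdD.
Qed.

(** The components off [e] are the antiderivatives divisible by their point;
    the component at the meeting point makes the sum vanish, and has the
    required power of the point as a factor by [lift_divides]. *)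
Lemma line_flow_lift e H m d s : e != H -> line_flow m H s -> homog_fun d s ->
  exists S, [/\ line_flow (e :: m) H S, homog_fun d.+1 S
              & forall p, ddir (ell e) (S p) = s p].
Proof.
move=> neH fs hs; have [p0 [ep0 Hp0 off]] := meeting_point neH.
have [supp sum0 dvd] := fs.
have /fin_all_exists[f hf] p : exists g : R, [/\ g \is d.+1.-homog,
    ~~ incident H p -> g = 0 & incident H p -> ~~ incident e p ->
    ddir (ell e) g = s p /\ divides (point p ^+ (cut m p).+1) g].
  have [Hp|nHp] := boolP (incident H p); last first.
    by exists 0; split=> //; rewrite dhomog0.
  have [ep|nep] := boolP (incident e p); first by exists 0; split; rewrite ?dhomog0.
  have hc : point p ^+ cut m p \is (cut m p).-homog.
    by have := dhomogMn (cut m p) (point_homog p); rewrite mul1n.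
  have [le|lt] := leqP (cut m p) d; last first.
    exists 0; split; rewrite ?dhomog0 // => _ _; rewrite ddir0.
    by rewrite (divides_homog_lt hc (hs p)) //; split=> //; apply: divides0.
  have hsp : s p \is (d - cut m p + cut m p).-homog by rewrite subnK.
  have [h hh def_s] := divides_homog hc hsp (dvd p).
  have [g hg dg] := ddir_antiderivative charK (cut m p) (ddir_point e p)
    (pairing_neq0 nep) (point_homog p) hh.
  exists (g * point p ^+ (cut m p).+1); split=> // [|_ _].
    have -> : d.+1 = (d - cut m p + (cut m p).+1)%N by rewrite addnS subnK.
    apply: dhomogM => //.
    by have := dhomogMn (cut m p).+1 (point_homog p); rewrite mul1n.
  by rewrite dg -def_s; split=> //; exists g.
pose S p := if p == p0 then - \sum_(q | q != p0) f q else f p.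
have hS : homog_fun d.+1 S.
  move=> p; rewrite /S; case: ifP => _; last by case: (hf p).
  by rewrite rpredN; apply: rpred_sum => q _; case: (hf q).
have suppS p : ~~ incident H p -> S p = 0.
  move=> nHp; have [_ h _] := hf p; rewrite /S ifN ?h //.
  by apply: contraNneq nHp => ->.
have sumS : \sum_p S p = 0.
  rewrite (bigD1 p0) //= {1}/S eqxx; apply/eqP; rewrite addrC subr_eq0; apply/eqP.
  by apply: eq_bigr => p /negbTE ne; rewrite /S ne.
have dS' p : p != p0 -> ddir (ell e) (S p) = s p.
  move=> ne; have [Hp|nHp] := boolP (incident H p); last first.
    by rewrite suppS // supp // ddir0.
  by rewrite /S (negbTE ne); have [_ _ h] := hf p; have [] := h Hp (off p Hp ne).
have dS p : ddir (ell e) (S p) = s p.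
  have [->|/dS'//] := eqVneq p p0.
  rewrite /S eqxx raddfN /= ddir_sum (eq_bigr s) => [|q ne].
    have := sum0; rewrite (bigD1 p0) //= => /eqP; rewrite addrC addr_eq0.
    by move/eqP->; rewrite opprK.
  by rewrite -(dS' q ne) /S (negbTE ne).
have dvdS' p : p != p0 -> divides (point p ^+ cut (e :: m) p) (S p).
  move=> ne; have [Hp|nHp] := boolP (incident H p); last first.
    by rewrite suppS //; apply: divides0.
  rewrite /cut /= (off p Hp ne) add1n /S (negbTE ne).
  by have [_ _ h] := hf p; have [] := h Hp (off p Hp ne).
exists S; split=> //; split=> // p; have [->|/dvdS'//] := eqVneq p p0.
rewrite /cut /= ep0 add0n.
exact: (lift_divides neH ep0 Hp0 off fs hs hS suppS sumS dS dvdS').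
Qed.

End Flows.

(** * Decomposing relations into flows along the lines *)

(** The lines through the first point partition the remaining points. *)
Lemma line_to_first (p : 'I_7) : p != ord0 ->
  exists H : 'I_6, forall H' : 'I_6,
    (incident H' 0 && incident H' p) = (H' == H).
Proof.
have /ord_all/(_ p) : all (fun p => (p != 0%N) ==> has (fun H => all (fun H' =>
  (incident H' 0 && incident H' p) == (H' == H)) (iota 0 6)) (iota 0 6)) (iota 0 7).
  by vm_compute.
move=> /implyP h ne; have /ord_has[H /ord_all hH] := h ne.
by exists H => H'; apply/eqP; apply: hH.
Qed.

Section Decomposition.
Variable K : fieldType.
Hypothesis charK : [pchar K] =i pred0.
Local Notation R := {mpoly K[3]}.
Implicit Types (e H : 'I_6) (p q : 'I_7) (m : seq 'I_6).
Implicit Types (G s S : 'I_7 -> R) (ss SS : 'I_6 -> 'I_7 -> R).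

Definition decomposes m d G ss : Prop :=
  [/\ forall H, line_flow m H (ss H), forall H, homog_fun d (ss H)
    & forall p, \sum_H ss H p = G p].

Lemma decomposes_ddir e m d G ss : decomposes (e :: m) d G ss ->
  decomposes m d.-1 (fun p => ddir (ell K e) (G p))
    (fun H p => ddir (ell K e) (ss H p)).
Proof.
case=> h1 h2 h3; split=> [H|H p|p]; first exact: ddir_line_flow.
  exact/ddir_homogB/h2.
by rewrite -ddir_sum h3.
Qed.

(** Lift every line but [e] separately; what is left of [G] is carried by
    [e], because off [e] both sides are the antiderivative of the same
    polynomial. *)
Lemma decomposes_lift e m d G ss :
    \sum_p G p = 0 -> (forall p, divides (point K p ^+ cut (e :: m) p) (G p)) ->
    homog_fun d.+1 G -> decomposes m d (fun p => ddir (ell K e) (G p)) ss ->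
  exists2 SS, decomposes (e :: m) d.+1 G SS &
    forall H p, ddir (ell K e) (SS H p) = ss H p.
Proof.
move=> sumG dvdG hG [fss hss sumss].
have /fin_all_exists[L hL] H : exists S, H != e ->
    [/\ line_flow (e :: m) H S, homog_fun d.+1 S
      & forall p, ddir (ell K e) (S p) = ss H p].
  have [->|ne] := eqVneq H e; first by exists (fun=> 0).
  rewrite eq_sym in ne.
  by have [S hS] := line_flow_lift charK ne (fss H) (hss H); exists S.
pose SS H p := if H == e then G p - \sum_(H' | H' != e) L H' p else L H p.
have SSe p : SS e p = G p - \sum_(H' | H' != e) L H' p by rewrite /SS eqxx.
have SSne H p : H != e -> SS H p = L H p by rewrite /SS => /negbTE->.
have dSS H p : ddir (ell K e) (SS H p) = ss H p.
  have [->|ne] := eqVneq H e; last by rewrite SSne //; case: (hL H ne).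
  rewrite SSe raddfB /= -sumss (bigD1 e) //= ddir_sum.
  rewrite -[RHS]addr0 -addrA; congr (_ + _); apply/eqP; rewrite subr_eq0; apply/eqP.
  by apply: eq_bigr => H' ne; case: (hL H' ne).
have hSS H : homog_fun d.+1 (SS H).
  move=> p; have [->|ne] := eqVneq H e; last by rewrite SSne //; case: (hL H ne).
  by rewrite SSe rpredB //; apply: rpred_sum => H' ne; case: (hL H' ne).
have sumSS p : \sum_H SS H p = G p.
  rewrite (bigD1 e) //= SSe (eq_bigr (fun H' => L H' p)) ?subrK // => H' ne.
  exact: SSne.
have dvdL H p : H != e -> divides (point K p ^+ cut (e :: m) p) (L H p).
  by move=> ne; case: (hL H ne) => -[].
have flowSS H : line_flow (e :: m) H (SS H).
  have [->|ne] := eqVneq H e; last first.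
    case: (hL H ne) => -[h1 h2 h3] _ _; split=> [p /h1||p]; rewrite ?SSne //.
    by rewrite (eq_bigr (L H)) // => p _; rewrite SSne.
  have dvde p : divides (point K p ^+ cut (e :: m) p) (SS e p).
    rewrite SSe; apply: dividesD => //; apply/dividesN/divides_sum => H'.
    exact: dvdL.
  split=> // [p nep|].
    apply: (ddir_inj charK (ddir_point K e p) (pairing_neq0 K nep)
      (point_homog K p) (hSS e p)).
      exact: (divides_cut_point nep (dvde p)).
    by rewrite dSS; case: (fss e) => h _ _; apply: h.
  under eq_bigr do rewrite SSe; rewrite sumrB sumG sub0r exchange_big big1 ?oppr0 //.
  by move=> H' ne; case: (hL H' ne) => -[].
by exists SS.
Qed.

(** By induction on [m].  Without divisibility condition, each component is
    moved to the first point along the line that joins them. *)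
Lemma decompose m d G : \sum_p G p = 0 ->
    (forall p, divides (point K p ^+ cut m p) (G p)) -> homog_fun d G ->
  exists SS, decomposes m d G SS.
Proof.
elim: m d G => [|e m IH] d G sumG dvdG hG.
  pose x : 'I_7 := ord0.
  pose SS H p : R := if incident H x then
    (if incident H p then (if p == x then - \sum_(q | (q != x) && incident H q) G q
       else G p) else 0) else 0.
  have ndvd p (g : R) : divides (point K p ^+ cut [::] p) g by exists g; rewrite mulr1.
  have sumSS p : p != x -> \sum_H SS H p = G p.
    move=> ne; have [H hH] := line_to_first ne.
    rewrite (bigD1 H) //= big1 ?addr0 => [|H' neH].
      by have := hH H; rewrite eqxx /SS => /andP[-> ->]; rewrite (negbTE ne).
    have := hH H'; rewrite (negbTE neH) /SS.
    by case: (incident H' x) => //= ->.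
  have flowSS H : line_flow [::] H (SS H).
    split=> // [p /negbTE nHp|]; first by rewrite /SS nHp if_same.
    have [Hx|/negbTE nHx] := boolP (incident H x); last by rewrite /SS nHx big1.
    rewrite /SS Hx (bigD1 x) //= ?eqxx ?Hx addrC; apply/eqP.
    rewrite subr_eq0; apply/eqP.
    by rewrite -big_mkcondr; apply: eq_bigr => p /andP[/negbTE->].
  exists SS; split=> // [H p|p].
    rewrite /SS; do 3?[case: ifP => _]; rewrite ?dhomog0 //.
    by rewrite rpredN; apply: rpred_sum.
  have [->|/sumSS//] := eqVneq p x; apply/eqP; rewrite -subr_eq0; apply/eqP.
  apply: (sum_eq0_last (F := fun p => \sum_H SS H p - G p)).
    rewrite sumrB sumG subr0 exchange_big big1 // => H _.
    by case: (flowSS H).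
  by move=> q /sumSS->; rewrite subrr.
case: d hG => [|d] hG.
  pose SS H p : R := if H == e then G p else 0.
  have G0 p : ~~ incident e p -> G p = 0.
    move=> nep; apply: (divides_homog_lt (point_homog K p) (hG p)) => //.
    exact: (divides_cut_point nep (dvdG p)).
  have sumSS p : \sum_H SS H p = G p by rewrite /SS -big_mkcond big_pred1_eq.
  exists SS; split=> // [H|H p]; last by rewrite /SS; case: ifP; rewrite ?dhomog0.
  rewrite /SS; case: eqVneq => [->|_]; first by split.
  by split=> // [|p]; rewrite ?big1 //; apply: divides0.
have [|||ss hss] := IH d (fun p => ddir (ell K e) (G p)).
- by rewrite -ddir_sum sumG ddir0.
- by move=> p; apply: ddir_divides_cut.
- by move=> p; apply: ddir_homog.
by have [SS hSS _] := decomposes_lift sumG dvdG hG hss; exists SS.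
Qed.

(** * Iterated derivatives *)

Definition iter_ddir m (g : R) : R := foldl (fun g e => ddir (ell K e) g) g m.

Lemma iter_ddir_is_linear m : linear (iter_ddir m).
Proof.
elim: m => [|e m IH] c g h //=.
by rewrite -IH /iter_ddir /= linearP.
Qed.

HB.instance Definition _ m :=
  GRing.isLinear.Build K R R _ (iter_ddir m) (iter_ddir_is_linear m).

Lemma iter_ddir_homog m d (g : R) : g \is (size m + d).-homog -> iter_ddir m g \is d.-homog.
Proof.
elim: m g => [|e m IH] g //= hg; apply: IH; exact: ddir_homog.
Qed.

Lemma iter_ddir_low m d (g : R) : g \is d.-homog -> (d < size m)%N -> iter_ddir m g = 0.
Proof.
elim: m d g => [|e m IH] [|d] g //= hg; last first.
  by move=> lt; apply: (IH d) => //; apply: ddir_homog.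
by rewrite /iter_ddir /= ddir_homog0 // => _; exact: (raddf0 (iter_ddir m)).
Qed.

Lemma line_flow_iter_ddir_inj m H d s : H \notin m -> line_flow m H s -> homog_fun d s ->
  (forall p, iter_ddir m (s p) = 0) -> forall p, s p = 0.
Proof.
elim: m d s => [|e m IH] d s //=; rewrite inE negb_or => /andP[neH nHm] fs hs ds.
rewrite eq_sym in neH; have [h1 h2 h3] := fs.
apply: (line_flow_inj charK neH hs) => // [p _ nep|].
  exact: (divides_cut_point nep (h3 p)).
apply: (IH d.-1 (fun p => ddir (ell K e) (s p))) => //; first exact: ddir_line_flow.
by move=> p; apply: ddir_homogB.
Qed.

Lemma line_flow_iter_ddir_lift m H d s : H \notin m -> line_flow [::] H s ->
    homog_fun d s ->
  exists S, [/\ line_flow m H S, homog_fun (size m + d) S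
              & forall p, iter_ddir m (S p) = s p].
Proof.
move=> + fs hs; elim: m => [|e m IH] /=; first by exists s.
rewrite inE negb_or eq_sym => /andP[neH /IH[S [fS hS dS]]].
have [S' [fS' hS' dS']] := line_flow_lift charK neH fS hS.
by exists S'; split=> // p; rewrite -dS -dS'.
Qed.

Lemma iter_ddir_decomposes m d G ss : decomposes m d G ss ->
  decomposes [::] (d - size m) (fun p => iter_ddir m (G p)) (fun H p => iter_ddir m (ss H p)).
Proof.
elim: m d G ss => [|e m IH] d G ss h; first by rewrite subn0.
by rewrite subnS -subn1 subnAC subn1; exact: (IH _ _ _ (decomposes_ddir h)).
Qed.

(** For each line [H <> e] the injectivity of the derivative along [e] on
    flows applies; the flow along [e] is then minus a sum of zeros. *)
Lemma decomposes_iter_ddir_inj m d ss : decomposes m d (fun=> 0) ss ->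
  (forall H p, iter_ddir m (ss H p) = 0) -> forall H p, ss H p = 0.
Proof.
elim: m d ss => [|e m IH] d ss //= h ds.
have dss : forall H p, ddir (ell K e) (ss H p) = 0.
  apply: (IH d.-1) => //; have := decomposes_ddir h.
  by case=> h1 h2 h3; split=> // p; rewrite h3 ddir0.
have [h1 h2 h3] := h.
have ss0 H : H != e -> forall p, ss H p = 0.
  rewrite eq_sym => ne; have [g1 g2 g3] := h1 H.
  apply: (line_flow_inj charK ne (h2 H)) => // p _ nep.
  exact: (divides_cut_point nep (g3 p)).
move=> H p; have [->|/ss0//] := eqVneq H e.
by apply: (sum_eq0_last (h3 p)) => H' /ss0.
Qed.

Lemma decomposes_iter_ddir_lift m d ss : decomposes [::] d (fun=> 0) ss ->
  exists2 SS, decomposes m (size m + d) (fun=> 0) SS &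
    forall H p, iter_ddir m (SS H p) = ss H p.
Proof.
move=> h0; elim: m => [|e m [SS hSS dSS]]; first by exists ss.
have [|p|p||SS' hSS' dSS'] := @decomposes_lift e m (size m + d) (fun=> 0) SS.
- by rewrite big1.
- exact: divides0.
- exact: dhomog0.
- by case: hSS => g1 g2 g3; split=> // p; rewrite g3 ddir0.
by exists SS' => // H p; rewrite -dSS -dSS'.
Qed.

End Decomposition.

(** * Bases of the syzygies along a line *)

Lemma line_pivot (H : 'I_6) : exists i j k : 'I_3,
  [/\ i != j, i != k & j != k] /\ line_coef H i = 1.
Proof.
have /ord_all/(_ H)/ord_has[i /ord_has[j /ord_has[k /and4P[h1 h2 h3 /eqP h4]]]] :
  all (fun H => has (fun i => has (fun j => has (fun k =>
    [&& i != j, i != k, j != k & line_coef H i == 1])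
    (iota 0 3)) (iota 0 3)) (iota 0 3)) (iota 0 6).
  by vm_compute.
by exists i, j, k.
Qed.

Lemma line_points (H : 'I_6) : exists a b c : 'I_7,
  [/\ a != b, a != c, b != c &
    forall p : 'I_7, incident H p = [|| p == a, p == b | p == c]].
Proof.
have /ord_all/(_ H)/ord_has[a /ord_has[b /ord_has[c /and4P[h1 h2 h3 /ord_all h4]]]] :
  all (fun H => has (fun a => has (fun b => has (fun c =>
    [&& a != b, a != c, b != c & all (fun p =>
      incident H p == [|| p == a, p == b | p == c]) (iota 0 7)])
    (iota 0 7)) (iota 0 7)) (iota 0 7)) (iota 0 6).
  by vm_compute.
by exists a, b, c; split=> // p; have /eqP := h4 p.
Qed.

Definition off_line (m : seq 'I_6) (h : nat) : nat := count (fun e : 'I_6 => (e : nat) != h) m.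

Definition shifts1 (m : seq 'I_6) : seq nat := mkseq (cut m) 7.

Section LineSyzygies.
Variable K : fieldType.
Hypothesis charK : [pchar K] =i pred0.
Local Notation R := {mpoly K[3]}.
Variables (m : seq 'I_6).
Local Notation F1 := (size (shifts1 m)).

Definition pow_point (p : 'I_7) : R := point K p ^+ cut m p.

Lemma pow_point_homog p : pow_point p \is (cut m p).-homog.
Proof. by have := dhomogMn (cut m p) (point_homog K p); rewrite mul1n. Qed.

Lemma pow_point_neq0 p : pow_point p != 0.
Proof. by rewrite expf_neq0 ?point_neq0. Qed.

Lemma nth_shifts1 (p : 'I_7) : nth 0%N (shifts1 m) p = cut m p.
Proof. exact: nth_mkseq. Qed.

Definition numerators (v : 'rV[R]_F1) (p : 'I_7) : R := v 0 p * pow_point p.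

Lemma numerators_homog e (v : 'rV[R]_F1) : ghomog e v -> homog_fun e (numerators v).
Proof.
move=> hv p; have := hv p; rewrite nth_shifts1 /numerators => -[h1 h2].
have [le|lt] := leqP (cut m p) e; last by rewrite h2 ?mul0r ?dhomog0.
rewrite -(subnK le); apply: dhomogM (pow_point_homog p); exact: h1.
Qed.

Lemma numerators_lift e (s : 'I_7 -> R) : homog_fun e s ->
    (forall p, divides (pow_point p) (s p)) ->
  exists2 v : 'rV[R]_F1, ghomog e v & forall p, numerators v p = s p.
Proof.
move=> hs dvd.
have /fin_all_exists[g hg] (p : 'I_7) : exists g : R,
   ((cut m p <= e)%N -> g \is (e - cut m p).-homog) /\ ((e < cut m p)%N -> g = 0) /\ g * pow_point p = s p.
  have [le|lt] := leqP (cut m p) e.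
    have hsp : s p \is (e - cut m p + cut m p).-homog by rewrite subnK.
    have [h hh ->] := divides_homog (pow_point_homog p) hsp (dvd p).
    by exists h; split=> //; split=> //; rewrite ltnNge le.
  exists 0; split; rewrite ?dhomog0 //; split=> //; rewrite mul0r.
  exact/esym/(divides_homog_lt (pow_point_homog p) (hs p)).
exists (\row_p g p) => [p|p]; last by rewrite /numerators mxE; case: (hg p) => _ [].
by rewrite nth_shifts1 mxE; case: (hg p) => h1 [h2 _].
Qed.

Lemma numerators_inj (v w : 'rV[R]_F1) : numerators v =1 numerators w -> v = w.
Proof.
move=> eq_vw; apply/rowP => p; have := eq_vw p.
by move/(mulIf (pow_point_neq0 _)).
Qed.

Variable H : 'I_6.
Let N := off_line m H.
Let mH := filter (predC1 H) m.

Lemma size_mH : size mH = N.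
Proof. by rewrite size_filter; apply: eq_count. Qed.

Lemma cut_mH p : incident H p -> cut mH p = cut m p.
Proof.
move=> Hp; rewrite /cut count_filter; apply: eq_count => e /=.
by case: eqVneq => [->|]; rewrite ?Hp ?andbT.
Qed.

Lemma notin_mH : H \notin mH.
Proof. by rewrite mem_filter /= eqxx. Qed.

Lemma line_flow_mH (s : 'I_7 -> R) : line_flow mH H s <-> line_flow m H s.
Proof.
by split=> -[h1 h2 h3]; split=> // p; have [i|/h1->] := boolP (incident H p);
  try exact: divides0; have := h3 p; rewrite cut_mH.
Qed.

(** The first differential of the resolution. *)
Definition power_column : 'M[R]_(F1, size [:: 0%N]) := \matrix_(p, _) pow_point p.

Lemma power_column_homog (p : 'I_F1) : ghomog (nth 0%N (shifts1 m) p) (row p power_column).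
Proof.
by move=> j; rewrite !mxE ord1 /= subn0 nth_shifts1; split=> // _; apply: pow_point_homog.
Qed.

Local Notation kerH := (in_kernel (fun p : 'I_F1 => incident H p) power_column).

Lemma mul_power_column (v : 'rV[R]_F1) j : (v *m power_column) 0 j = \sum_p numerators v p.
Proof. by rewrite mxE; apply: eq_bigr => p _; rewrite mxE. Qed.

Lemma kernel_line_flow v : kerH v <-> line_flow m H (numerators v).
Proof.
split=> [[sv kv]|[h1 h2 _]].
  split=> [p nHp||p]; first by rewrite /numerators (sv p nHp) mul0r.
    by rewrite -(mul_power_column _ ord0) kv mxE.
  by exists (v 0 p).
split=> [p nHp|]; last by apply/rowP => j; rewrite mul_power_column h2 mxE.
have /eqP := h1 p nHp; rewrite mulf_eq0 (negbTE (pow_point_neq0 _)) orbF.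
by move/eqP.
Qed.

(** The powers on [H] involve only two of three coordinates: setting the
    third one to zero retracts onto them. *)
Lemma line_saturated (i : 'I_3) (c : 'rV[R]_(size [:: 0%N])) (u : 'rV[R]_F1) :
    line_coef H i = 1 -> supported (fun p : 'I_F1 => incident H p) u ->
    'X_i *: c = u *m power_column ->
  exists2 w, supported (fun p : 'I_F1 => incident H p) w & c = w *m power_column.
Proof.
move=> ci su def_c; pose sig : {rmorphism R -> R} := subst_form (ell K H) ('X_i : R).
have sigX : sig 'X_i = 0 by rewrite /sig /= subst_formX /ell ci scale1r subrr.
have sigP (p : 'I_7) : incident H p -> sig (pow_point p) = pow_point p.
  move=> /eqP Hp; rewrite /pow_point rmorphXn /=; congr (_ ^+ _).
  rewrite /sig /= subst_form_linform -[RHS]subr0; congr (_ - _).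
  have := ddir_linform (ell K H) (fun i : 'I_3 => (point_coef p i)%:~R).
  rewrite -/(point K p) ddir_point Hp => /eqP; rewrite -subr_eq0 -mpolyCB mpolyC_eq0.
  by rewrite sub0r oppr_eq0 => /eqP->; rewrite scale0r.
have [p|w [def_w sw]] := @divides_row K _ 'X_i (u - map_mx sig u).
  by rewrite !mxE; apply: subst_form_sub.
have supw : supported (fun p : 'I_F1 => incident H p) w.
  by move=> p nHp; apply: sw; rewrite !mxE (su p nHp) rmorph0 subrr.
exists w => //; apply: (@scaleX_inj _ _ i); rewrite scalemxAl -def_w mulmxBl def_c.
suff -> : map_mx sig u *m power_column = 0 by rewrite subr0.
have : map_mx sig (u *m power_column) = 0.
  by rewrite -def_c; apply/rowP => j; rewrite !mxE rmorphM /= sigX mul0r.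
rewrite map_mxM => <-; apply/rowP => j; rewrite !mxE; apply: eq_bigr => p _; rewrite !mxE.
have [Hp|nHp] := boolP (incident H p); first by rewrite sigP.
by rewrite (su p nHp) rmorph0 !mul0r.
Qed.

(** The module of flows along [H] is free on two flows of degree [N]: those
    whose iterated derivative along the lines off [H] is constant. *)
Lemma line_basis : exists S : 'M[R]_(2, F1),
  [/\ forall l, ghomog N (row l S), forall l, line_flow m H (numerators (row l S)),
      forall a : 'rV_2, a *m S = 0 -> a = 0
    & forall e v, line_flow m H (numerators v) -> ghomog e v ->
      exists2 a : 'rV[R]_(size [:: N; N]), ghomog e a & v = a *m S].
Proof.
have [a [b [c [ab ac bc inc]]]] := line_points H.
have [i [j [k [ijk ci]]]] := line_pivot H.
pose es := [:: N; N].
pose D (v : 'rV[R]_F1) : 'rV[R]_(size es) :=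
  \row_l iter_ddir mH (numerators v (if l == 0 then a else b)).
have numD u v p : numerators (u + v) p = numerators u p + numerators v p.
  by rewrite /numerators mxE mulrDl.
have numZ (x : K) v p : numerators (x%:MP *: v) p = x *: numerators v p.
  by rewrite /numerators mxE mul_mpolyC scalerAl.
have D_add u v : D (u + v) = D u + D v.
  by apply/rowP => l; rewrite !mxE numD raddfD.
have D_scale x v : D (x%:MP *: v) = x%:MP *: D v.
  by apply/rowP => l; rewrite !mxE numZ linearZ /= mul_mpolyC.
have D_homog d v : kerH v -> ghomog (N + d) v -> forall l, D v 0 l \is d.-homog.
  move=> _ /numerators_homog hv l; rewrite mxE; apply: iter_ddir_homog.
  by rewrite size_mH; apply: hv.
have D_low e v : kerH v -> ghomog e v -> (e < N)%N -> D v = 0.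
  move=> _ /numerators_homog hv lt; apply/rowP => l; rewrite !mxE.
  by apply: iter_ddir_low (hv _) _; rewrite size_mH.
have D_inj e v : kerH v -> ghomog e v -> D v = 0 -> v = 0.
  move=> kv hv /rowP Dv0; apply: numerators_inj => p.
  have fv := (kernel_line_flow v).1 kv; have [supp sum0 _] := fv.
  have da : iter_ddir mH (numerators v a) = 0 by have := Dv0 ord0; rewrite !mxE.
  have db : iter_ddir mH (numerators v b) = 0 by have := Dv0 ord_max; rewrite !mxE.
  rewrite {2}/numerators mxE mul0r.
  apply: (line_flow_iter_ddir_inj charK notin_mH ((line_flow_mH _).2 fv) (numerators_homog hv)).
  have d0 q : q != c -> iter_ddir mH (numerators v q) = 0.
    move=> nqc; have [Hq|/supp->] := boolP (incident H q); last exact: raddf0.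
    by move: Hq; rewrite inc (negbTE nqc) orbF => /orP[/eqP->|/eqP->].
  move=> q; have [->|/d0//] := eqVneq q c.
  apply: (sum_eq0_last (F := fun q => iter_ddir mH (numerators v q))) => //.
  by rewrite -raddf_sum sum0 raddf0.
have /fin_all_exists[s hs] (l : 'I_2) : exists v : 'rV[R]_F1,
    [/\ ghomog N v, kerH v & D v = delta_mx 0 l].
  pose t (p : 'I_7) : R := if p == (if l == 0 then a else b) then 1
    else if p == c then -1 else 0.
  have nzc : (if l == 0 then a else b) != c by case: ifP.
  have ft : line_flow [::] H t.
    split=> [p||p].
    - rewrite inc !negb_or => /and3P[/negbTE na /negbTE nb /negbTE nc].
      by rewrite /t nc; case: ifP => // /eqP; case: ifP => _ /eqP; rewrite ?na ?nb.
    - rewrite (bigD1 c) //= (bigD1 (if l == 0 then a else b)) //= big1 => [|p].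
        by rewrite /t eqxx eq_sym (negbTE nzc) eqxx addr0 addNr.
      by case/andP=> /negbTE nc /negbTE nx; rewrite /t nc nx.
    - by exists (t p); rewrite mulr1.
  have ht : homog_fun 0 t.
    move=> p; rewrite /t; do 2?[case: ifP => _]; rewrite ?dhomog0 ?dhomog1 //.
    by rewrite rpredN dhomog1.
  have [S [fS hS dS]] := line_flow_iter_ddir_lift charK notin_mH ft ht.
  have fS' : line_flow m H S by apply/line_flow_mH.
  rewrite size_mH addn0 in hS.
  have [_ _ dvd] := fS'; have [v hv nv] := numerators_lift hS dvd.
  exists v; split=> //.
    apply/kernel_line_flow; case: fS' => h1 h2 h3; split=> [p|| p]; rewrite ?nv; auto.
    by rewrite -[RHS]h2; apply: eq_bigr => p _.
  apply/rowP => l'; rewrite !mxE nv dS /t /=.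
  have -> : (l' == l) = ((if l' == 0 then a else b) == (if l == 0 then a else b)).
    have nba : (b == a) = false by rewrite eq_sym (negbTE ab).
    case: l' l {t nzc ft ht S fS hS dS fS' dvd v hv nv} => -[|[|//]] h1 [[|[|//]] h2];
    by rewrite /= ?eqxx ?(negbTE ab) ?nba.
  have nzc' : (if l' == 0 then a else b) != c by case: ifP.
  by case: eqP => // _; rewrite (negbTE nzc').
pose S : 'M[R]_(size es, F1) := \matrix_(l, p) s l 0 p.
have rowS l : row l S = s l by apply/rowP => p; rewrite !mxE.
have es_const (l : 'I_(size es)) : nth 0%N es l = N by case: l => -[|[|]].
have S_ker l : kerH (row l S) by rewrite rowS; case: (hs l).
have S_hom l : ghomog N (row l S) by rewrite rowS; case: (hs l).
have D_S l : D (row l S) = delta_mx 0 l by rewrite rowS; case: (hs l).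
have sat := @line_saturated i; exists S; split=> //.
- by move=> l; apply/kernel_line_flow.
- exact: (rows_independent ijk (fun c u su => sat c u ci su) power_column_homog
    es_const D_add D_scale D_low D_inj S_ker S_hom D_S).
- move=> e v /kernel_line_flow kv hv.
  exact: (free_kernel ijk (fun c u su => sat c u ci su) power_column_homog es_const
    D_add D_scale D_homog D_low D_inj S_ker S_hom D_S kv hv).
Qed.

End LineSyzygies.

(** * Constant flows on the arrangement *)

(** Six flags that serve as coordinates on the constant flows. *)
Definition flags : seq (nat * nat) :=
  [:: (1, 0); (2, 0); (3, 6); (4, 6); (2, 3); (1, 4)]%N.

Definition flag_line (c : nat) : nat := (nth (0, 0) flags c).1%N.
Definition flag_point (c : nat) : nat := (nth (0, 0) flags c).2%N.

(** The constant flow with given coordinates, one row per incident flag. *)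
Definition flow_table : seq ((nat * nat) * seq int) :=
  [:: ((1, 0)%N, [:: 1; 0; 0; 0; 0; 0]);
      ((2, 0)%N, [:: 0; 1; 0; 0; 0; 0]);
      ((3, 6)%N, [:: 0; 0; 1; 0; 0; 0]);
      ((4, 6)%N, [:: 0; 0; 0; 1; 0; 0]);
      ((2, 3)%N, [:: 0; 0; 0; 0; 1; 0]);
      ((1, 4)%N, [:: 0; 0; 0; 0; 0; 1]);
      ((5, 0)%N, [:: -1; -1; 0; 0; 0; 0]);
      ((5, 6)%N, [:: 0; 0; -1; -1; 0; 0]);
      ((3, 3)%N, [:: 0; 0; 0; 0; -1; 0]);
      ((4, 4)%N, [:: 0; 0; 0; 0; 0; -1]);
      ((1, 2)%N, [:: -1; 0; 0; 0; 0; -1]);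
      ((2, 1)%N, [:: 0; -1; 0; 0; -1; 0]);
      ((3, 2)%N, [:: 0; 0; -1; 0; 1; 0]);
      ((4, 1)%N, [:: 0; 0; 0; -1; 0; 1]);
      ((5, 5)%N, [:: 1; 1; 1; 1; 0; 0]);
      ((0, 1)%N, [:: 0; 1; 0; 1; 1; -1]);
      ((0, 2)%N, [:: 1; 0; 1; 0; -1; 1]);
      ((0, 5)%N, [:: -1; -1; -1; -1; 0; 0])].

Definition const_flow (c h a : nat) : int :=
  nth 0 (nth [::] (unzip2 flow_table) (index (h, a) (unzip1 flow_table))) c.

Lemma flag_lineP (c : 'I_6) : (flag_line c < 6)%N.
Proof. by apply: (@ord_all 6 (fun c => flag_line c < 6)%N); vm_compute. Qed.

Lemma flag_pointP (c : 'I_6) : (flag_point c < 7)%N.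
Proof. by apply: (@ord_all 6 (fun c => flag_point c < 7)%N); vm_compute. Qed.

Definition flagL (c : 'I_6) : 'I_6 := Ordinal (flag_lineP c).
Definition flagP (c : 'I_6) : 'I_7 := Ordinal (flag_pointP c).

Definition sum_iota (n : nat) (f : nat -> int) : int := foldr +%R 0 (map f (iota 0 n)).

Lemma sum_iotaE n (f : nat -> int) : \sum_(i < n) f i = sum_iota n f.
Proof.
rewrite -(big_mkord xpredT f) /index_iota subn0 /sum_iota.
by elim: (iota 0 n) => [|a s IH]; rewrite ?big_nil // big_cons IH.
Qed.

Lemma const_flow_supp (c H : 'I_6) (p : 'I_7) : ~~ incident H p -> const_flow c H p = 0.
Proof.
have /ord_all/(_ c)/ord_all/(_ H)/ord_all/(_ p) : all (fun c => all (fun h =>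
  all (fun a => incident h a || (const_flow c h a == 0)) (iota 0 7)) (iota 0 6)) (iota 0 6).
  by vm_compute.
by move=> /orP[->|/eqP].
Qed.

Lemma const_flow_line (c H : 'I_6) : \sum_(p < 7) const_flow c H p = 0.
Proof.
rewrite (sum_iotaE 7 (const_flow c H)); apply/eqP.
by move: H; apply: (@ord_all 6 (fun h => sum_iota 7 (const_flow c h) == 0));
  move: c; apply: (@ord_all 6 (fun c => all (fun h =>
    sum_iota 7 (const_flow c h) == 0) (iota 0 6)));
  vm_compute.
Qed.

Lemma const_flow_point (c : 'I_6) (p : 'I_7) : \sum_(H < 6) const_flow c H p = 0.
Proof.
rewrite (sum_iotaE 6 (fun h => const_flow c h p)); apply/eqP.
by move: p; apply: (@ord_all 7 (fun a => sum_iota 6 (fun h => const_flow c h a) == 0));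
  move: c; apply: (@ord_all 6 (fun c => all (fun a =>
    sum_iota 6 (fun h => const_flow c h a) == 0) (iota 0 7)));
  vm_compute.
Qed.

Lemma const_flow_flag (c c' : 'I_6) :
  const_flow c (flagL c') (flagP c') = (c' == c)%:R.
Proof.
apply/eqP; move: c'; apply: (@ord_all 6 (fun c' =>
  const_flow c (flag_line c') (flag_point c') == (c' == c)%:R)).
by move: c; apply: (@ord_all 6 (fun c => all (fun c' =>
  const_flow c (flag_line c') (flag_point c') == (c' == c)%:R) (iota 0 6))); vm_compute.
Qed.

(** Flags where a constant flow must vanish, given a set of flags where it
    is known to vanish: all other flags on the line, or through the point,
    are known. *)
Definition spread (known : nat -> nat -> bool) (h a : nat) : bool :=
  [|| known h a, all (fun h' => (h' == h) || known h' a) (iota 0 6)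
    | all (fun a' => (a' == a) || known h a') (iota 0 7)].

Definition known_flags (h a : nat) : bool := ~~ incident h a || ((h, a) \in flags).

Section ConstantFlows.
Variable V : zmodType.
Variable w : 'I_6 -> 'I_7 -> V.
Hypothesis w_supp : forall (H : 'I_6) (p : 'I_7), ~~ incident H p -> w H p = 0.
Hypothesis w_line : forall H, \sum_p w H p = 0.
Hypothesis w_point : forall p, \sum_H w H p = 0.

Lemma spread_vanish (known : nat -> nat -> bool) :
    (forall (H : 'I_6) (p : 'I_7), known H p -> w H p = 0) ->
  forall (H : 'I_6) (p : 'I_7), spread known H p -> w H p = 0.
Proof.
move=> kn H p /or3P[/kn//|/ord_all h|/ord_all h].
  have := w_point p; rewrite (bigD1 H) //= big1 ?addr0 // => H' ne.
  by apply: kn; have := h H'; rewrite (negbTE (ne : (H' : nat) != H)).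
have := w_line H; rewrite (bigD1 p) //= big1 ?addr0 // => p' ne.
by apply: kn; have := h p'; rewrite (negbTE (ne : (p' : nat) != p)).
Qed.

Lemma constant_flow_eq0 : (forall c, w (flagL c) (flagP c) = 0) ->
  forall H p, w H p = 0.
Proof.
move=> w0.
have k0 (H : 'I_6) (p : 'I_7) : known_flags H p -> w H p = 0.
  case/orP=> [/w_supp//|/(nthP (0, 0)%N)[c lt def_c]].
  have <- : flagL (Ordinal lt) = H by apply/val_inj; rewrite /= /flag_line def_c.
  have <- : flagP (Ordinal lt) = p by apply/val_inj; rewrite /= /flag_point def_c.
  exact: w0.
have k3 : forall (H : 'I_6) (p : 'I_7), iter 3 spread known_flags H p -> w H p = 0.
  by do 3!apply: spread_vanish.
move=> H p; apply: k3.
have /ord_all/(_ H)/ord_all : all (fun h => all (fun a =>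
  iter 3 spread known_flags h a) (iota 0 7)) (iota 0 6).
  by vm_compute.
exact.
Qed.

End ConstantFlows.

(** * Syzygies of the seven powers *)

Definition shifts2 (m : seq 'I_6) : seq nat := mkseq (fun i => off_line m i./2) 12.
Definition shifts3 (m : seq 'I_6) : seq nat := nseq 6 (size m).

Section Resolution.
Variable K : fieldType.
Hypothesis charK : [pchar K] =i pred0.
Local Notation R := {mpoly K[3]}.
Variables (m : seq 'I_6).
Local Notation F1 := (size (shifts1 m)).
Local Notation F2 := (size (shifts2 m)).
Local Notation F3 := (size (shifts3 m)).

Variable LS : 'I_6 -> 'M[R]_(2, F1).
Hypothesis LS_homog : forall (H : 'I_6) l, ghomog (off_line m H) (row l (LS H)).
Hypothesis LS_flow : forall (H : 'I_6) l, line_flow m H (numerators (row l (LS H))).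
Hypothesis LS_indep : forall H (a : 'rV_2), a *m LS H = 0 -> a = 0.
Hypothesis LS_gen : forall (H : 'I_6) e v, line_flow m H (numerators v) -> ghomog e v ->
  exists2 a : 'rV[R]_(size [:: off_line m H; off_line m H]),
    ghomog e a & v = a *m LS H.

Definition half_ord (i : 'I_12) : 'I_6 := inord (i : nat)./2.
Definition odd_ord (i : 'I_12) : 'I_2 := inord (odd i).
Definition pair_ord (H : 'I_6) (j : 'I_2) : 'I_12 := inord ((H : nat).*2 + j).

Lemma half_ordE i : half_ord i = (i : nat)./2 :> nat.
Proof. by rewrite inordK //; have := ltn_ord i; lia. Qed.

Lemma odd_ordE i : odd_ord i = odd i :> nat.
Proof. by rewrite inordK //; case: (odd i). Qed.

Lemma pair_ordE H j : pair_ord H j = ((H : nat).*2 + j)%N :> nat.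
Proof. by rewrite inordK //; have := ltn_ord H; have := ltn_ord j; lia. Qed.

Lemma half_pair H j : half_ord (pair_ord H j) = H.
Proof. by apply/val_inj; rewrite /= half_ordE pair_ordE; have := ltn_ord j; lia. Qed.

Lemma odd_pair H j : odd_ord (pair_ord H j) = j.
Proof. by apply/val_inj; rewrite /= odd_ordE pair_ordE; have := ltn_ord j; lia. Qed.

Lemma pair_half_odd i : pair_ord (half_ord i) (odd_ord i) = i.
Proof. by apply/val_inj; rewrite /= pair_ordE half_ordE odd_ordE; lia. Qed.

Lemma sum_pair_ord (V : zmodType) (F : 'I_12 -> V) :
  \sum_i F i = \sum_H \sum_j F (pair_ord H j).
Proof.
rewrite pair_bigA /= (reindex (fun q => pair_ord q.1 q.2)) //=.
exists (fun i => (half_ord i, odd_ord i)) => [[H j] _|i _] /=.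
  by rewrite half_pair odd_pair.
exact: pair_half_odd.
Qed.

(** The second differential: its rows are the chosen bases of the syzygies
    along the lines, two rows for each line. *)
Definition line_syz : 'M[R]_(F2, F1) :=
  \matrix_(i, p) LS (half_ord i) (odd_ord i) p.

Definition block (v : 'rV[R]_F2) (H : 'I_6) : 'rV[R]_2 := \row_j v 0 (pair_ord H j).

Lemma nth_shifts2 (i : 'I_12) : nth 0%N (shifts2 m) i = off_line m (half_ord i).
Proof. by rewrite half_ordE; apply: nth_mkseq. Qed.

Lemma row_line_syz (i : 'I_12) : row i line_syz = row (odd_ord i) (LS (half_ord i)).
Proof. by apply/rowP => p; rewrite !mxE. Qed.

Lemma line_syz_homog (i : 'I_F2) : ghomog (nth 0%N (shifts2 m) i) (row i line_syz).
Proof. by rewrite nth_shifts2 row_line_syz. Qed.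

Lemma mul_line_syz (v : 'rV[R]_F2) : v *m line_syz = \sum_H block v H *m LS H.
Proof.
apply/rowP => p; rewrite mxE summxE (sum_pair_ord (fun i => v 0 i * line_syz i p)).
apply: eq_bigr => H _; rewrite mxE; apply: eq_bigr => j _.
by rewrite !mxE half_pair odd_pair.
Qed.

Lemma numeratorsD (u v : 'rV[R]_F1) p :
  numerators (u + v) p = numerators u p + numerators v p.
Proof. by rewrite /numerators mxE mulrDl. Qed.

Lemma numerators0 p : numerators (0 : 'rV[R]_F1) p = 0.
Proof. by rewrite /numerators mxE mul0r. Qed.

Lemma numerators_sum (I : finType) (F : I -> 'rV[R]_F1) p :
  numerators (\sum_i F i) p = \sum_i numerators (F i) p.
Proof.
by apply: (big_morph (fun v => numerators v p)) => [u v|];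
  rewrite ?numeratorsD ?numerators0.
Qed.

Lemma line_flowD (H : 'I_6) (s t : 'I_7 -> R) : line_flow m H s -> line_flow m H t ->
  line_flow m H (fun p => s p + t p).
Proof.
move=> [s1 s2 s3] [t1 t2 t3]; split=> [p nHp||p]; first by rewrite s1 // t1 // addr0.
  by rewrite big_split /= s2 t2 addr0.
exact: dividesD.
Qed.

Lemma line_flow_comb H (a : 'rV[R]_2) : line_flow m H (numerators (a *m LS H)).
Proof.
rewrite mulmx_sum_row; elim/big_ind: _ => [|u v fu fv|l _].
- split=> [p _||p]; rewrite ?numerators0 //; last exact: divides0.
  by rewrite big1 // => p _; rewrite numerators0.
- have [h1 h2 h3] := line_flowD fu fv.
  split=> [p /h1||p]; rewrite ?numeratorsD //.
  by rewrite -[RHS]h2; apply: eq_bigr => p _; rewrite numeratorsD.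
- have [h1 h2 h3] := LS_flow H l.
  have E p : numerators (a 0 l *: row l (LS H)) p = a 0 l * numerators (row l (LS H)) p.
    by rewrite /numerators !mxE mulrA.
  split=> [p nHp||p]; first by rewrite E h1 ?mulr0.
    by under eq_bigr do rewrite E; rewrite -mulr_sumr h2 mulr0.
  by rewrite E; apply: dividesMl.
Qed.

Lemma ghomog_block e (v : 'rV[R]_F2) (H : 'I_6) : ghomog e v ->
  @ghomog K 3 [:: off_line m H; off_line m H] e (block v H).
Proof.
move=> hv j; have := hv (pair_ord H j); rewrite nth_shifts2 half_pair mxE.
by case: j => -[|[|]].
Qed.

Lemma ghomog_LS e (v : 'rV[R]_F2) (H : 'I_6) : ghomog e v -> ghomog e (block v H *m LS H).
Proof.
move=> hv; have hb := @ghomog_block e v H hv; apply: (ghomog_mulmx _ hb) => l.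
by have -> : nth 0%N [:: off_line m H; off_line m H] l = off_line m H by case: l => -[|[|]].
Qed.

Lemma assemble e G ss : decomposes m e G ss -> exists2 v : 'rV[R]_F2,
  ghomog e v & forall H p, numerators (block v H *m LS H) p = ss H p.
Proof.
case=> fss hss _.
have /fin_all_exists[a ha] (H : 'I_6) : exists a : 'rV[R]_2,
    @ghomog K 3 [:: off_line m H; off_line m H] e a /\
    forall p, numerators (a *m LS H) p = ss H p.
  have [h1 h2 h3] := fss H; have [w hw nw] := numerators_lift (hss H) h3.
  have fw : line_flow m H (numerators w).
    split=> [p /h1||p]; rewrite ?nw //.
    by rewrite -[RHS]h2; apply: eq_bigr => p _.
  by have [a ha def_w] := LS_gen fw hw; exists a; rewrite -def_w.
pose v : 'rV[R]_F2 := \row_i a (half_ord i) 0 (odd_ord i).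
have bv H : block v H = a H.
  by apply/rowP => j; rewrite !mxE half_pair odd_pair.
exists v => [i|H p]; last by rewrite bv; case: (ha H).
rewrite nth_shifts2 mxE; have [h _] := ha (half_ord i).
by have := h (odd_ord i); case: (odd_ord i) => -[|[|]].
Qed.

Lemma blocks_decompose e (v : 'rV[R]_F2) : ghomog e v ->
  decomposes m e (numerators (v *m line_syz)) (fun H => numerators (block v H *m LS H)).
Proof.
move=> hv; split=> [H|H|p].
- exact: line_flow_comb.
- exact/numerators_homog/ghomog_LS.
- by rewrite mul_line_syz numerators_sum.
Qed.

(** Multiplied by the powers of the points, a syzygy falls under [decompose],
    and each summand is a combination of the basis of its line. *)
Lemma exact_F1_homog e (v : 'rV[R]_F1) : ghomog e v -> v *m power_column K m = 0 ->
  exists u : 'rV[R]_F2, v = u *m line_syz.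
Proof.
move=> hv v0; have [|p||ss hss] := @decompose K charK m e (numerators v).
- by rewrite -(mul_power_column _ ord0) v0 mxE.
- by exists (v 0 p).
- exact: numerators_homog.
have [u hu nu] := assemble hss; exists u; apply: numerators_inj => p.
by rewrite mul_line_syz numerators_sum; case: hss => _ _ <-; apply: eq_bigr => H _.
Qed.

(** Exactness can be checked on homogeneous vectors, because a matrix that
    preserves degrees commutes with taking components. *)
Lemma exact_of_homog ds ds' r (A : 'M[R]_(size ds, size ds')) (B : 'M[R]_(r, size ds)) :
    (forall i : 'I_(size ds), ghomog (nth 0%N ds i) (row i A)) ->
    (forall e (v : 'rV_(size ds)), ghomog e v -> v *m A = 0 -> exists u, v = u *m B) ->
  forall v : 'rV_(size ds), v *m A = 0 -> exists u, v = u *m B.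
Proof.
move=> hA ex v v0; have [b ->] := vcomp_sum v.
have /fin_all_exists[u hu] (e : 'I_b) : exists u, vcomp e v = u *m B.
  apply: (ex e); first exact: vcomp_homog.
  by rewrite -(vcompM _ _ hA) v0; apply/rowP => j; rewrite !mxE raddf0 if_same.
by exists (\sum_e u e); rewrite mulmx_suml; apply: eq_bigr.
Qed.

Lemma exact_F1 (v : 'rV[R]_F1) : v *m power_column K m = 0 ->
  exists u : 'rV[R]_F2, v = u *m line_syz.
Proof. exact: (exact_of_homog (@power_column_homog K m) exact_F1_homog). Qed.

Lemma line_syz_power : line_syz *m power_column K m = 0.
Proof.
apply/row_matrixP => i; rewrite row_mul row0 row_line_syz.
by apply/rowP => j; rewrite mul_power_column mxE; case: (LS_flow (half_ord i) (odd_ord i)).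
Qed.

Local Notation kerS := (in_kernel (predT : pred 'I_F2) line_syz).

(** The kernel of [line_syz] is free on six elements of degree [size m]: the flows
    whose iterated derivative along all the lines is a basic constant flow. *)
Lemma second_syzygies : exists S : 'M[R]_(F3, F2),
  [/\ forall l, ghomog (size m) (row l S), S *m line_syz = 0,
      forall a : 'rV_F3, a *m S = 0 -> a = 0
    & forall e (v : 'rV_F2), v *m line_syz = 0 -> ghomog e v ->
      exists2 a : 'rV[R]_F3, ghomog e a & v = a *m S].
Proof.
pose fl (v : 'rV[R]_F2) H := numerators (block v H *m LS H).
pose D (v : 'rV[R]_F2) : 'rV[R]_F3 :=
  \row_(c < F3) iter_ddir m (fl v (flagL c) (flagP c)).
have kerE v : kerS v <-> v *m line_syz = 0 by split=> [[]|] //; split=> // l.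
have flD u v H p : fl (u + v) H p = fl u H p + fl v H p.
  rewrite /fl -numeratorsD -mulmxDl; congr (numerators (_ *m _) _).
  by apply/rowP => j; rewrite !mxE.
have flZ (x : K) v H p : fl (x%:MP *: v) H p = x *: fl v H p.
  rewrite /fl; have -> : block (x%:MP *: v) H = x%:MP *: block v H.
    by apply/rowP => j; rewrite !mxE.
  by rewrite /numerators -scalemxAl [X in X * _]mxE mul_mpolyC scalerAl.
have fl_dec e v : kerS v -> ghomog e v -> decomposes m e (fun=> 0) (fl v).
  move=> /kerE kv /blocks_decompose; rewrite kv => -[h1 h2 h3]; split=> // p.
  by rewrite h3 numerators0.
have D_add u v : D (u + v) = D u + D v.
  by apply/rowP => c; rewrite !mxE flD raddfD.
have D_scale x v : D (x%:MP *: v) = x%:MP *: D v.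
  by apply/rowP => c; rewrite !mxE flZ linearZ /= mul_mpolyC.
have D_homog d v : kerS v -> ghomog (size m + d) v -> forall c, D v 0 c \is d.-homog.
  move=> kv hv c; rewrite mxE; apply: iter_ddir_homog.
  by case: (fl_dec _ _ kv hv) => _ h _; apply: h.
have D_low e v : kerS v -> ghomog e v -> (e < size m)%N -> D v = 0.
  move=> kv hv lt; apply/rowP => c; rewrite !mxE; apply: iter_ddir_low lt.
  by case: (fl_dec _ _ kv hv) => _ h _; apply: h.
have D_inj e v : kerS v -> ghomog e v -> D v = 0 -> v = 0.
  move=> kv hv /rowP Dv0; have dec := fl_dec e v kv hv.
  have dd0 : forall H p, iter_ddir m (fl v H p) = 0.
    have [c1 _ c3] := iter_ddir_decomposes dec.
    apply: constant_flow_eq0 => [H p|H|p|c].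
    - by case: (c1 H) => h _ _; apply: h.
    - by case: (c1 H).
    - by rewrite c3; apply: raddf0.
    - by have := Dv0 c; rewrite !mxE.
  have fl0 := decomposes_iter_ddir_inj charK dec dd0.
  have b0 H : block v H = 0.
    apply: LS_indep; apply: numerators_inj => p.
    by rewrite numerators0; apply: fl0.
  apply/rowP => i; rewrite mxE; have /rowP/(_ (odd_ord i)) := b0 (half_ord i).
  by rewrite !mxE pair_half_odd.
have /fin_all_exists[s hs] (c : 'I_6) : exists v : 'rV[R]_F2,
    [/\ ghomog (size m) v, kerS v & D v = delta_mx 0 (c : 'I_F3)].
  pose w (H : 'I_6) (p : 'I_7) : R := ((const_flow c H p)%:~R : K)%:MP.
  have dw : decomposes [::] 0 (fun=> 0) w.
    split=> [H|H p|p].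
    - split=> [p nHp||p]; first by rewrite /w const_flow_supp.
        by rewrite /w -!rmorph_sum /= const_flow_line.
      by exists (w H p); rewrite mulr1.
    - by rewrite /w -[_%:MP]mulr1 mul_mpolyC rpredZ // dhomog1.
    - by rewrite /w -!rmorph_sum /= const_flow_point.
  have [ss hss dss] := decomposes_iter_ddir_lift charK m dw.
  rewrite addn0 in hss; have [v hv nv] := assemble hss.
  exists v; split=> //.
    apply/kerE; apply: numerators_inj => p; rewrite mul_line_syz numerators_sum numerators0.
    by case: hss => _ _ h; rewrite -[RHS](h p); apply: eq_bigr => H _.
  apply/rowP => c'; rewrite !mxE /fl nv dss /w const_flow_flag.
  by rewrite rmorph_nat mpolyC_nat.
pose S : 'M[R]_(F3, F2) := \matrix_(c, i) s c 0 i.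
have rowS c : row c S = s c by apply/rowP => i; rewrite !mxE.
have es_const (l : 'I_F3) : nth 0%N (shifts3 m) l = size m by rewrite nth_nseq ltn_ord.
have S_ker l : kerS (row l S) by rewrite rowS; case: (hs l).
have S_hom l : ghomog (size m) (row l S) by rewrite rowS; case: (hs l).
have D_S l : D (row l S) = delta_mx 0 l by rewrite rowS; case: (hs l).
pose i0 : 'I_3 := @Ordinal 3 0 isT.
have ijk : [/\ i0 != @Ordinal 3 1 isT, i0 != @Ordinal 3 2 isT
  & @Ordinal 3 1 isT != @Ordinal 3 2 isT] by [].
have sat (c : 'rV[R]_F1) (u : 'rV[R]_F2) : supported (predT : pred 'I_F2) u ->
    'X_i0 *: c = u *m line_syz ->
    exists2 w, supported (predT : pred 'I_F2) w & c = w *m line_syz.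
  move=> _ def_c; have [|w ->] := @exact_F1 c; last by exists w.
  apply: (@scaleX_inj _ _ i0); rewrite scaler0 scalemxAl def_c.
  by rewrite -mulmxA line_syz_power mulmx0.
exists S; split=> //.
- by apply/row_matrixP => l; rewrite row_mul row0; apply/kerE.
- exact: (rows_independent ijk sat line_syz_homog es_const
    D_add D_scale D_low D_inj S_ker S_hom D_S).
- move=> e v /kerE kv hv.
  exact: (free_kernel ijk sat line_syz_homog es_const
    D_add D_scale D_homog D_low D_inj S_ker S_hom D_S kv hv).
Qed.

End Resolution.

(** * The irrelevant ideal *)

Section Irrelevant.
Variables (K : fieldType) (n : nat).
Local Notation R := {mpoly K[n]}.

Lemma irrelevant_idealP (g : R) :
  irrelevant_ideal g <-> exists f : 'I_n -> R, g = \sum_i f i * 'X_i.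
Proof.
have nthX (i : nat) (lt : (i < n)%N) : [seq ('X_j : R) | j : 'I_n]`_i = 'X_(Ordinal lt).
  have -> : [seq ('X_j : R) | j : 'I_n] = codom (fun j : 'I_n => 'X_j : R) by [].
  rewrite (nth_map (Ordinal lt)) ?size_enum_ord //; congr ('X_ _).
  by apply/val_inj; rewrite /= nth_enum_ord.
have sz : size [seq ('X_j : R) | j : 'I_n] = n by rewrite size_map size_enum_ord.
split=> [[c ->]|[f ->]].
  exists (fun i => c (cast_ord (esym sz) i)).
  rewrite (reindex (cast_ord (esym sz))) /=; last first.
    by exists (cast_ord sz) => i _; rewrite ?cast_ordK ?cast_ordKV.
  by apply: eq_bigr => -[i lt] _ /=; rewrite nthX.
exists (fun i => f (cast_ord sz i)).
rewrite [RHS](reindex (cast_ord (esym sz))) /=; last first.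
  by exists (cast_ord sz) => i _; rewrite ?cast_ordK ?cast_ordKV.
by apply: eq_bigr => -[i lt] _ /=; rewrite nthX cast_ordKV.
Qed.

Lemma irrelevant_ideal0 : irrelevant_ideal (0 : R).
Proof.
by apply/irrelevant_idealP; exists (fun=> 0); rewrite big1 // => i _; rewrite mul0r.
Qed.

Lemma irrelevant_idealD (g h : R) :
  irrelevant_ideal g -> irrelevant_ideal h -> irrelevant_ideal (g + h).
Proof.
move=> /irrelevant_idealP[f ->] /irrelevant_idealP[f' ->].
apply/irrelevant_idealP; exists (fun i => f i + f' i).
by rewrite -big_split; apply: eq_bigr => i _; rewrite mulrDl.
Qed.

Lemma irrelevant_idealMl (a g : R) : irrelevant_ideal g -> irrelevant_ideal (a * g).
Proof.
move=> /irrelevant_idealP[f ->]; apply/irrelevant_idealP; exists (fun i => a * f i).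
by rewrite mulr_sumr; apply: eq_bigr => i _; rewrite mulrA.
Qed.

(** Euler's formula again. *)
Lemma irrelevant_homog d (g : R) : [pchar K] =i pred0 -> g \is d.-homog -> (0 < d)%N ->
  irrelevant_ideal g.
Proof.
case: d => // d charK hg _; apply/irrelevant_idealP.
exists (fun i => (d.+1%:R)^-1 *: g^`M(i)).
under eq_bigr do rewrite -scalerAl mulrC.
by rewrite -scaler_sumr (euler_homog hg) scalerA mulVf ?natS_neq0 ?scale1r.
Qed.

Lemma irrelevant_mulmx r s (v : 'rV[R]_r) (A : 'M[R]_(r, s)) j :
  (forall i, irrelevant_ideal (A i j)) -> irrelevant_ideal ((v *m A) 0 j).
Proof.
move=> hA; rewrite mxE; elim/big_ind: _ => [||i _].
- exact: irrelevant_ideal0.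
- exact: irrelevant_idealD.
- exact: irrelevant_idealMl.
Qed.

End Irrelevant.

(** * The resolution for an arbitrary multiset of lines *)

Section Main.
Variable K : fieldType.
Hypothesis charK : [pchar K] =i pred0.
Local Notation R := {mpoly K[3]}.
Implicit Types m : seq 'I_6.

Definition cut_powers m : seq R :=
  mkseq (fun a => linform (fun i : 'I_3 => (point_coef a i)%:~R) ^+ cut m a) 7.

Definition all_shifts m : seq (seq nat) := [:: shifts1 m; shifts2 m; shifts3 m].

Definition mk_differentials m (A1 : 'M[R]_(size (shifts1 m), size [:: 0%N]))
    (A2 : 'M[R]_(size (shifts2 m), size (shifts1 m)))
    (A3 : 'M[R]_(size (shifts3 m), size (shifts2 m))) :
    differentials K 3 (all_shifts m) :=
  fun i => match i return
      {linear gfree K 3 (shift (all_shifts m) i.+1) -> gfree K 3 (shift (all_shifts m) i)} with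
    | 0%N => mulmxr A1
    | 1%N => mulmxr A2
    | 2%N => mulmxr A3
    | _ => \0
    end.

(** The matrices are minimal because the degrees strictly increase along every
    nonzero entry: an entry in the row of a line [H] is nonzero only at points
    of [H], so the degrees of other points do not matter. *)
Lemma resolution_exists m : exists d : differentials K 3 (all_shifts m),
  graded_free_resolution (ideal_gen (cut_powers m)) d /\
  ((forall p : 'I_7, 0 < cut m p)%N ->
   (forall (H : 'I_6) (p : 'I_7), incident H p -> (cut m p < off_line m H)%N) ->
   (forall H : 'I_6, off_line m H < size m)%N -> minimal_differentials d).
Proof.
have /fin_all_exists[LS hLS] := fun H => line_basis charK m H.
have LS_homog (H : 'I_6) l : ghomog (off_line m H) (row l (LS H)) by case: (hLS H).
have LS_flow (H : 'I_6) l : line_flow m H (numerators (row l (LS H))) by case: (hLS H).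
have LS_indep (H : 'I_6) (a : 'rV_2) : a *m LS H = 0 -> a = 0.
  by case: (hLS H) => _ _ h _; apply: h.
have LS_gen (H : 'I_6) e v : line_flow m H (numerators v) -> ghomog e v ->
  exists2 a : 'rV[R]_(size [:: off_line m H; off_line m H]),
    ghomog e a & v = a *m LS H by case: (hLS H) => _ _ _ h; apply: h.
have [D3 [D3_homog D3_D2 D3_indep D3_gen]] :=
  second_syzygies charK LS_homog LS_flow LS_indep LS_gen.
have D3h (i : 'I_(size (shifts3 m))) : ghomog (nth 0%N (shifts3 m) i) (row i D3).
  by rewrite nth_nseq ltn_ord.
exists (mk_differentials (power_column K m) (line_syz LS) D3); split; first split.
- case=> [|[|[|i]]] e v hv.
  + exact: (ghomog_mulmx (@power_column_homog K m) hv).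
  + exact: (ghomog_mulmx (line_syz_homog LS_homog) hv).
  + exact: (ghomog_mulmx D3h hv).
  + by move=> k; rewrite mxE; split=> // _; apply: dhomog0.
- move=> p; split=> [[c ->]|[v <-]].
  + exists (\row_i c i : 'rV_(size (shifts1 m))).
    rewrite /= /mulmxr mxE; apply: eq_bigr => i _; rewrite !mxE; congr (_ * _).
    by rewrite nth_mkseq.
  + exists (fun i => v 0 i); rewrite /= /mulmxr mxE; apply: eq_bigr => i _.
    by rewrite mxE; congr (_ * _); rewrite nth_mkseq.
- case=> [|[|[|i]]] v /=.
  + split=> [v0|[w <-]]; last by rewrite /mulmxr -mulmxA line_syz_power ?mulmx0.
    by have [u ->] := exact_F1 charK LS_gen v0; exists u.
  + split=> [v0|[w <-]]; last by rewrite /mulmxr -mulmxA D3_D2 mulmx0.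
    have [u ->] : exists u, v = u *m D3; last by exists u.
    apply: (exact_of_homog (line_syz_homog LS_homog) _ v0) => e w hw w0.
    by have [u _ def_w] := D3_gen e w w0 hw; exists u.
  + split=> [/D3_indep->|[w <-]]; last by rewrite /mulmxr mul0mx.
    by exists 0.
  + split=> _; last by [].
    by exists 0; apply/rowP; case: i v => [|i] v [].
- move=> cut_gt0 cut_lt off_lt; case=> [|[|[|i]]] v j.
  + apply: irrelevant_mulmx => p; rewrite mxE.
    exact: irrelevant_homog charK (pow_point_homog K m p) (cut_gt0 p).
  + apply: irrelevant_mulmx => i; rewrite mxE; set H := half_ord i; set a := odd_ord i.
    have [Hp|nHp] := boolP (incident H j); last first.
      have [supp _ _] := LS_flow H a; have := supp j nHp.
      rewrite /numerators mxE => /eqP; rewrite mulf_eq0 (negbTE (pow_point_neq0 _ _ _)) orbF.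
      by move/eqP->; apply: irrelevant_ideal0.
    have lt := cut_lt H j Hp; have := LS_homog H a j; rewrite nth_shifts1 mxE => -[h _].
    by apply: irrelevant_homog charK (h (ltnW lt)) _; rewrite subn_gt0.
  + apply: irrelevant_mulmx => c; have := D3_homog c j; rewrite nth_shifts2 mxE => -[h _].
    have lt := off_lt (half_ord j).
    by apply: irrelevant_homog charK (h (ltnW lt)) _; rewrite subn_gt0.
  + by rewrite mxE; apply: irrelevant_ideal0.
Qed.

End Main.

(** * The ideal of the theorem *)

Definition edges (l k : nat) : seq 'I_6 :=
  nseq l (@Ordinal 6 0 isT) ++ nseq l (@Ordinal 6 1 isT) ++ nseq l (@Ordinal 6 2 isT)
  ++ nseq k (@Ordinal 6 3 isT) ++ nseq k (@Ordinal 6 4 isT) ++ nseq k (@Ordinal 6 5 isT).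

Lemma count_edges (P : pred nat) l k : count (fun e : 'I_6 => P e) (edges l k)
  = ((P 0 + P 1 + P 2) * l + (P 3 + P 4 + P 5) * k)%N.
Proof. by rewrite !count_cat !count_nseq /=; lia. Qed.

Lemma cut_edges l k (p : 'I_7) : cut (edges l k) p =
  nth 0%N [:: l + 2 * k; l + 2 * k; l + 2 * k; 2 * l + 2 * k; 2 * l + 2 * k;
    2 * l + 2 * k; 3 * l]%N p.
Proof.
rewrite /cut (count_edges (fun e => ~~ incident e p)).
by case: p => -[|[|[|[|[|[|[|//]]]]]]] lt; rewrite /incident /=; lia.
Qed.

Lemma off_line_edges l k (H : 'I_6) : off_line (edges l k) H =
  nth 0%N [:: 2 * l + 3 * k; 2 * l + 3 * k; 2 * l + 3 * k;
    3 * l + 2 * k; 3 * l + 2 * k; 3 * l + 2 * k]%N H.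
Proof.
rewrite /off_line (count_edges (fun e => e != H)).
by case: H => -[|[|[|[|[|[|//]]]]]] lt /=; lia.
Qed.

Lemma size_edges l k : size (edges l k) = (3 * l + 3 * k)%N.
Proof. by rewrite !size_cat !size_nseq; lia. Qed.

Lemma phi_shiftsE l k : phi_shifts l k = all_shifts (edges l k).
Proof.
have c := cut_edges l k; have o := off_line_edges l k.
congr [:: _; _; _].
- by rewrite /shifts1 /mkseq /= (c ord0) (c (@Ordinal 7 1 isT)) (c (@Ordinal 7 2 isT))
    (c (@Ordinal 7 3 isT)) (c (@Ordinal 7 4 isT)) (c (@Ordinal 7 5 isT)) (c (@Ordinal 7 6 isT)).
- by rewrite /shifts2 /mkseq /= (o ord0) (o (@Ordinal 6 1 isT)) (o (@Ordinal 6 2 isT))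
    (o (@Ordinal 6 3 isT)) (o (@Ordinal 6 4 isT)) (o (@Ordinal 6 5 isT)).
- by rewrite /shifts3 size_edges.
Qed.

Lemma linform3 (K : fieldType) (c : 'I_3 -> K) : linform c =
  c (@Ordinal 3 0 isT) *: 'X_(@Ordinal 3 0 isT) + c (@Ordinal 3 1 isT) *: 'X_(@Ordinal 3 1 isT)
  + c (@Ordinal 3 2 isT) *: 'X_(@Ordinal 3 2 isT).
Proof.
rewrite /linform !big_ord_recl big_ord0 addr0 addrA.
by congr (c _ *: 'X_ _ + c _ *: 'X_ _ + c _ *: 'X_ _); apply/val_inj.
Qed.

Lemma J_phiE (K : fieldType) l k : J_phi K l k = ideal_gen (cut_powers K (edges l k)).
Proof.
rewrite /J_phi; congr (ideal_gen _); have c := cut_edges l k.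
rewrite /cut_powers /mkseq /= (c ord0) (c (@Ordinal 7 1 isT)) (c (@Ordinal 7 2 isT))
    (c (@Ordinal 7 3 isT)) (c (@Ordinal 7 4 isT)) (c (@Ordinal 7 5 isT)) (c (@Ordinal 7 6 isT)).
by rewrite !linform3 /= !mulr1z !mulr0z !scale1r !scale0r ?addr0 ?add0r.
Qed.

Theorem theorem2p8 (K : fieldType) (charK : [pchar K] =i pred0) (l k : nat)
    (phi_gt0 : forall r : nat, (1 <= r <= 3)%N -> (0 < l + k * (3 - r))%N) :
  exists d : differentials K 3 (phi_shifts l k),
    graded_free_resolution (J_phi K l k) d /\
    ((0 < k)%N -> minimal_differentials d).
Proof.
have l_gt0 : (0 < l)%N by have := phi_gt0 3%N isT; rewrite subnn muln0 addn0.
rewrite phi_shiftsE J_phiE; have [d [res minim]] := resolution_exists charK (edges l k).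
exists d; split=> // k_gt0; apply: minim => [p|H p|H].
- by rewrite cut_edges; case: p => -[|[|[|[|[|[|[|//]]]]]]] lt /=; lia.
- rewrite cut_edges off_line_edges.
  case: H => -[|[|[|[|[|[|//]]]]]] lt; case: p => -[|[|[|[|[|[|[|//]]]]]]] lt' //= _; lia.
- rewrite off_line_edges size_edges.
  by case: H => -[|[|[|[|[|[|//]]]]]] lt /=; lia.
Qed.
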